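(* Let $c_o\in\mathbf{R}$ and let $X:\Sigma\to\mathbf{R}^3$ be an axially symmetric immersion of a topological disc, with axis of rotation the $z$-axis, which is critical for the Helfrich energy $\mathcal{H}[\Sigma]=\int_\Sigma (H+c_o)^2\,d\Sigma$. Then the surface is either a planar disc with $H\equiv -c_o=0$, or a spherical cap with $H\equiv -c_o\neq 0$, or, after a suitable vertical translation (i.e. replacing $X$ by $X+tE_3$ for a suitable $t\in\mathbf{R}$, $E_3=(0,0,1)$), the mean curvature of the immersion satisfies $$H+c_o=-\frac{\nu_3}{z}$$ on $\Sigma$.
   Context: $\Sigma$ is a compact, connected, oriented surface with smooth boundary and $X:\Sigma\to\mathbf{R}^3$ is an immersion of class $\mathcal{C}^4$ up to the boundary, with unit normal $\nu$ (oriented so that $\nu$ points out of convex domains). $H$ is the mean curvature with sign convention $2H=-\mathrm{tr}(d\nu)$, equivalently $\Delta X=2H\nu$ (so the round sphere of radius $R$ with outward normal has $H=-1/R$), and $K$ is the Gaussian curvature; $\Delta$ is the Laplacian of the induced metric. $z=X\cdot E_3$ and $\nu_3=\nu\cdot E_3$. The immersion is critical for $\mathcal{H}$ if it is critical with respect to compactly supported variations, i.e. if $\Delta H+2(H+c_o)(H[H-c_o]-K)=0$ in the interior of $\Sigma$. Axially symmetric means that the surface is a surface of revolution, obtained by rotating a planar profile curve about an axis (here the $z$-axis). For a disc, the profile curve starts on the axis. The equation $H+c_o=-\nu_3/z$ is understood at points where $z=0$ by continuity, i.e. as $(H+c_o)z=-\nu_3$ on $\Sigma$. *)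

(* Defs.v *)
From Stdlib Require Import Reals.
From Coquelicot Require Import Coquelicot.
Open Scope R_scope.

Definition vec3 : Type := (R * R * R)%type.

Definition c1 (p : vec3) : R := fst (fst p).
Definition c2 (p : vec3) : R := snd (fst p).
Definition c3 (p : vec3) : R := snd p.

Definition zero3 : vec3 := (0, 0, 0).
Definition E3 : vec3 := (0, 0, 1).
Definition add3 (p q : vec3) : vec3 := (c1 p + c1 q, c2 p + c2 q, c3 p + c3 q).
Definition sub3 (p q : vec3) : vec3 := (c1 p - c1 q, c2 p - c2 q, c3 p - c3 q).
Definition scal3 (a : R) (p : vec3) : vec3 := (a * c1 p, a * c2 p, a * c3 p).
Definition dot3 (p q : vec3) : R := c1 p * c1 q + c2 p * c2 q + c3 p * c3 q.
Definition cross3 (p q : vec3) : vec3 :=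
  (c2 p * c3 q - c3 p * c2 q,
   c3 p * c1 q - c1 p * c3 q,
   c1 p * c2 q - c2 p * c1 q).
Definition norm3 (p : vec3) : R := sqrt (dot3 p p).

(** Parameter domain: a compact surface of disc type is identified with the
    closed unit disc of the (u, v)-plane.  Maps on the disc are total functions
    on the plane; their values away from the disc are irrelevant. *)

Definition closed_disc (u v : R) : Prop := u ^ 2 + v ^ 2 <= 1.
Definition open_disc (u v : R) : Prop := u ^ 2 + v ^ 2 < 1.

(** Class C^n up to the boundary: the function is C^n on a neighbourhood of
    every point of the closed disc, boundary points included. *)
Definition Cn_on_disc (n : nat) (f : R -> R -> R) : Prop :=
  forall u v, closed_disc u v -> locally_2d (fun x y => ex_diff_n f n x y) u v.

Definition Du (f : R -> R -> R) (u v : R) : R := Derive (fun t => f t v) u.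
Definition Dv (f : R -> R -> R) (u v : R) : R := Derive (fun t => f u t) v.

Definition Du3 (X : R -> R -> vec3) (u v : R) : vec3 :=
  (Du (fun x y => c1 (X x y)) u v,
   Du (fun x y => c2 (X x y)) u v,
   Du (fun x y => c3 (X x y)) u v).
Definition Dv3 (X : R -> R -> vec3) (u v : R) : vec3 :=
  (Dv (fun x y => c1 (X x y)) u v,
   Dv (fun x y => c2 (X x y)) u v,
   Dv (fun x y => c3 (X x y)) u v).

Definition immersion_C4 (X : R -> R -> vec3) : Prop :=
  Cn_on_disc 4 (fun u v => c1 (X u v)) /\
  Cn_on_disc 4 (fun u v => c2 (X u v)) /\
  Cn_on_disc 4 (fun u v => c3 (X u v)) /\
  (forall u v, closed_disc u v -> cross3 (Du3 X u v) (Dv3 X u v) <> zero3).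

(** First fundamental form. *)
Definition gE (X : R -> R -> vec3) (u v : R) : R := dot3 (Du3 X u v) (Du3 X u v).
Definition gF (X : R -> R -> vec3) (u v : R) : R := dot3 (Du3 X u v) (Dv3 X u v).
Definition gG (X : R -> R -> vec3) (u v : R) : R := dot3 (Dv3 X u v) (Dv3 X u v).
Definition gdet (X : R -> R -> vec3) (u v : R) : R :=
  gE X u v * gG X u v - (gF X u v) ^ 2.

(** Unit normal for the standard orientation of the disc.  The opposite
    orientation is obtained by precomposing X with (u, v) |-> (v, u). *)
Definition normal (X : R -> R -> vec3) (u v : R) : vec3 :=
  let w := cross3 (Du3 X u v) (Dv3 X u v) in scal3 (/ norm3 w) w.

(** 2H = - tr(d nu) and K = det(d nu), where d nu is the tangent endomorphism
    sending X_i to nu_i: its matrix is B g^-1, with B_ij = <nu_i, X_j>. *)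
Definition mean_curvature (X : R -> R -> vec3) (u v : R) : R :=
  let nu_u := Du3 (normal X) u v in
  let nu_v := Dv3 (normal X) u v in
  - (1 / 2) *
  ((dot3 nu_u (Du3 X u v) * gG X u v
    - (dot3 nu_u (Dv3 X u v) + dot3 nu_v (Du3 X u v)) * gF X u v
    + dot3 nu_v (Dv3 X u v) * gE X u v) / gdet X u v).

Definition gauss_curvature (X : R -> R -> vec3) (u v : R) : R :=
  let nu_u := Du3 (normal X) u v in
  let nu_v := Dv3 (normal X) u v in
  (dot3 nu_u (Du3 X u v) * dot3 nu_v (Dv3 X u v)
   - dot3 nu_u (Dv3 X u v) * dot3 nu_v (Du3 X u v)) / gdet X u v.

(** Laplace-Beltrami operator of the induced metric,
    (1 / sqrt g) d_i (sqrt g g^ij d_j f). *)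
Definition laplacian (X : R -> R -> vec3) (f : R -> R -> R) (u v : R) : R :=
  / sqrt (gdet X u v) *
  (Du (fun x y => (gG X x y * Du f x y - gF X x y * Dv f x y)
                  / sqrt (gdet X x y)) u v
   + Dv (fun x y => (gE X x y * Dv f x y - gF X x y * Du f x y)
                    / sqrt (gdet X x y)) u v).

(** Criticality for the integral of (H + c0)^2 under compactly supported
    variations, expressed by the Euler-Lagrange equation in the interior. *)
Definition helfrich_critical (c0 : R) (X : R -> R -> vec3) : Prop :=
  forall u v, open_disc u v ->
    let H := mean_curvature X u v in
    let K := gauss_curvature X u v in
    laplacian X (mean_curvature X) u v
    + 2 * (H + c0) * (H * (H - c0) - K) = 0.

Definition disc_diffeo_C4 (phi : R -> R -> R * R) : Prop :=
  let a := fun u v => fst (phi u v) in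
  let b := fun u v => snd (phi u v) in
  Cn_on_disc 4 a /\
  Cn_on_disc 4 b /\
  (forall u v, closed_disc u v -> closed_disc (a u v) (b u v)) /\
  (forall u v u' v', closed_disc u v -> closed_disc u' v' ->
     phi u v = phi u' v' -> (u, v) = (u', v')) /\
  (forall u v, closed_disc u v ->
     exists u' v', closed_disc u' v' /\ phi u' v' = (u, v)) /\
  (forall u v, closed_disc u v ->
     Du a u v * Dv b u v - Dv a u v * Du b u v <> 0).

(** Up to a reparametrisation phi of the disc, X is obtained by rotating about
    the z-axis the profile curve s |-> (r s, 0, h s), which starts on the axis;
    (s, theta) are polar coordinates in the parameter disc. *)
Definition axially_symmetric (X : R -> R -> vec3) : Prop :=
  exists (phi : R -> R -> R * R) (r h : R -> R),
    disc_diffeo_C4 phi /\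
    r 0 = 0 /\
    (forall s theta, 0 <= s <= 1 ->
       let p := phi (s * cos theta) (s * sin theta) in
       X (fst p) (snd p) = (r s * cos theta, r s * sin theta, h s)).

(** X is a one-to-one parametrisation of the subset S of R^3. *)
Definition parametrises (X : R -> R -> vec3) (S : vec3 -> Prop) : Prop :=
  (forall u v, closed_disc u v -> S (X u v)) /\
  (forall p, S p -> exists u v, closed_disc u v /\ X u v = p) /\
  (forall u v u' v', closed_disc u v -> closed_disc u' v' ->
     X u v = X u' v' -> (u, v) = (u', v')).

Definition planar_disc (X : R -> R -> vec3) : Prop :=
  exists (c n : vec3) (rad : R),
    norm3 n = 1 /\ 0 < rad /\
    parametrises X (fun p => dot3 (sub3 p c) n = 0 /\ norm3 (sub3 p c) <= rad).

Definition spherical_cap (X : R -> R -> vec3) : Prop :=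
  exists (c n : vec3) (rad d : R),
    norm3 n = 1 /\ 0 < rad /\ - rad < d < rad /\
    parametrises X (fun p => norm3 (sub3 p c) = rad /\ d <= dot3 (sub3 p c) n).

Definition translate_z (t : R) (X : R -> R -> vec3) (u v : R) : vec3 :=
  add3 (X u v) (scal3 t E3).

(** H + c0 = - nu_3 / z, cleared of the denominator so as to make sense
    (by continuity) where z = 0. *)
Definition reduced_membrane (c0 : R) (X : R -> R -> vec3) : Prop :=
  forall u v, closed_disc u v ->
    (mean_curvature X u v + c0) * dot3 (X u v) E3 = - dot3 (normal X u v) E3.

(* Main.v *)
From Stdlib Require Import Reals Ranalysis5 Lra Lia Psatz FunctionalExtensionality.
From Coquelicot Require Import Coquelicot.
Require Import Defs.
Open Scope R_scope.

(** Write f = H + c0, let N be the vertical component of the unit normal and z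
    the height.  Criticality says that f solves the linear equation
    Delta f + q f = 0 with q = 2 (H (H - c0) - K).  The classical formulas

      Delta N = - (4 H^2 - 2 K) N - 2 grad H . grad z,    Delta z = 2 H N

    show that w = N + f (z - c) solves the same equation for every constant c.
    On a surface of revolution w only depends on the distance s to the centre
    along a meridian, and the equation becomes a linear ordinary differential
    equation of second order which is singular at s = 0.  Its solutions that
    are regular at the centre are determined by their value there
    ([singular_ode_unique], [profile_linear]).

    If f does not vanish at the centre, c can be chosen so that w does; then w
    vanishes identically, which is the equation H + c0 = - N / z after a
    vertical translation ([reduced_membrane_case]).  If f vanishes at the
    centre, then f vanishes identically, and H = - c0 is constant.  The first
    integral of surfaces of revolution of constant mean curvature then forces
    the profile to be a straight segment or a circular arc centred on the axis
    ([cmc_profile]); it has not returned to the axis, since the immersion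
    condition along the parallels keeps the radius away from zero.  Hence the
    surface is a planar disc or a spherical cap ([planar_case],
    [spherical_case]).

    The equation on the profile is obtained by pulling everything back to
    polar coordinates (s, t) of the rotationally symmetric parametrisation
    ([revolution_profile_eqs]).  The Laplacian is transported as the divergence
    of the vector field sqrt g grad H, whose flux through the coordinate lines
    is computed in both parametrisations ([flux_polar], [flux_divergence]).
    The unit normal gives a smooth frame (C, S) with position derivative
    v (C, S), where v is a signed speed; this makes all formulas independent of
    the orientation of the reparametrisation and of the sign of the radius. *)

(** * Functions of class C^n near a point of the plane *)

Definition Ck (n : nat) (f : R -> R -> R) (x y : R) : Prop :=
  locally_2d (fun u v => ex_diff_n f n u v) x y.

(** The closure properties below are proved by induction on the order, through
    this recursive form. *)
Lemma Ck_S (n : nat) (f : R -> R -> R) (x y : R) :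
  Ck (S n) f x y <->
  locally_2d (fun u v => continuity_2d_pt f u v /\
                         ex_derive (fun t => f t v) u /\
                         ex_derive (fun t => f u t) v) x y
  /\ Ck n (Du f) x y /\ Ck n (Dv f) x y.
Proof.
  unfold Ck; split.
  - intros [d Hd].
    split; [| split]; exists d; intros u v Hu Hv;
      destruct (Hd u v Hu Hv) as (H1 & H2 & H3 & H4 & H5); tauto.
  - intros (H1 & H2 & H3).
    generalize (locally_2d_and _ _ _ _ H1 (locally_2d_and _ _ _ _ H2 H3)).
    intros [d Hd]; exists d; intros u v Hu Hv.
    specialize (Hd u v Hu Hv); cbn; tauto.
Qed.

Lemma Ck_ext_loc (n : nat) (f g : R -> R -> R) (x y : R) :
  locally_2d (fun u v => f u v = g u v) x y -> Ck n f x y -> Ck n g x y.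
Proof.
  intros Hfg Hf; unfold Ck in *.
  apply locally_2d_impl_strong with (2 := Hfg).
  apply locally_2d_impl with (2 := Hf).
  apply locally_2d_forall; intros u v H1 H2.
  apply ex_diff_n_ext_loc with (1 := H2); assumption.
Qed.

Lemma Ck_ext (n : nat) (f g : R -> R -> R) (x y : R) :
  (forall u v, f u v = g u v) -> Ck n f x y -> Ck n g x y.
Proof.
  intros Hfg; apply Ck_ext_loc, locally_2d_forall, Hfg.
Qed.

Lemma Ck_le (n m : nat) (f : R -> R -> R) (x y : R) :
  (m <= n)%nat -> Ck n f x y -> Ck m f x y.
Proof.
  intros Hmn [d Hd]; exists d; intros u v Hu Hv.
  apply ex_diff_n_m with n; auto.
Qed.

Lemma Ck_Du (n : nat) (f : R -> R -> R) (x y : R) :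
  Ck (S n) f x y -> Ck n (Du f) x y.
Proof. rewrite Ck_S; tauto. Qed.

Lemma Ck_Dv (n : nat) (f : R -> R -> R) (x y : R) :
  Ck (S n) f x y -> Ck n (Dv f) x y.
Proof. rewrite Ck_S; tauto. Qed.

Lemma Ck_continuous_loc (n : nat) (f : R -> R -> R) (x y : R) :
  Ck n f x y -> locally_2d (fun u v => continuity_2d_pt f u v) x y.
Proof.
  intros H; destruct (Ck_le n 0 f x y (Nat.le_0_l n) H) as [d Hd].
  exists d; intros u v Hu Hv; apply (Hd u v Hu Hv).
Qed.

Lemma Ck_continuous (n : nat) (f : R -> R -> R) (x y : R) :
  Ck n f x y -> continuity_2d_pt f x y.
Proof.
  intros H; apply (locally_2d_singleton _ x y (Ck_continuous_loc n f x y H)).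
Qed.

Lemma Ck_0 (f : R -> R -> R) (x y : R) :
  locally_2d (fun u v => continuity_2d_pt f u v) x y -> Ck 0 f x y.
Proof.
  intros [d Hd]; exists d; intros u v Hu Hv; split; auto.
Qed.

Lemma Ck_ex_derive_loc (n : nat) (f : R -> R -> R) (x y : R) :
  Ck (S n) f x y ->
  locally_2d (fun u v => continuity_2d_pt f u v /\
                         ex_derive (fun t => f t v) u /\
                         ex_derive (fun t => f u t) v) x y.
Proof. rewrite Ck_S; tauto. Qed.

(** Differentiability follows from the existence of both partial derivatives
    and the continuity of the first one. *)
Lemma Ck_differentiable (f : R -> R -> R) (x y : R) :
  Ck 1 f x y -> differentiable_pt_lim f x y (Du f x y) (Dv f x y).
Proof.
  intros H.
  apply filterdiff_differentiable_pt_lim.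
  assert (Hd := Ck_ex_derive_loc 0 f x y H).
  apply filterdiff_ext_lin with
    (fun u : R * R => plus (scal (fst u) (Du f x y)) (scal (snd u) (Dv f x y))).
  2: { intros u; reflexivity. }
  apply (is_derive_filterdiff f x y (fun u v => Du f u v) (Dv f x y)).
  - apply (locally_2d_locally
      (fun u v => is_derive (fun z : R => f z v) u (Du f u v)) x y).
    apply locally_2d_impl with (2 := Hd).
    apply locally_2d_forall; intros u v (_ & Hu & _).
    apply Derive_correct; exact Hu.
  - apply Derive_correct.
    apply (locally_2d_singleton _ x y Hd).
  - apply continuity_2d_pt_filterlim.
    apply (Ck_continuous 0), Ck_Du, H.
Qed.

Lemma Ck_const (n : nat) (c x y : R) : Ck n (fun _ _ => c) x y.
Proof.
  revert c; induction n as [|n IH]; intros c.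
  - apply Ck_0, locally_2d_forall; intros; apply continuity_2d_pt_const.
  - apply Ck_S; split; [| split].
    + apply locally_2d_forall; intros u v; split; [| split].
      * apply continuity_2d_pt_const.
      * apply @ex_derive_const.
      * apply @ex_derive_const.
    + apply Ck_ext with (fun _ _ => 0); [| apply IH].
      intros; unfold Du; rewrite Derive_const; reflexivity.
    + apply Ck_ext with (fun _ _ => 0); [| apply IH].
      intros; unfold Dv; rewrite Derive_const; reflexivity.
Qed.

Lemma Ck_plus (n : nat) (f g : R -> R -> R) (x y : R) :
  Ck n f x y -> Ck n g x y -> Ck n (fun u v => f u v + g u v) x y.
Proof.
  revert f g; induction n as [|n IH]; intros f g Hf Hg.
  - apply Ck_0.
    generalize (locally_2d_and _ _ _ _ (Ck_continuous_loc _ _ _ _ Hf)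
                  (Ck_continuous_loc _ _ _ _ Hg)).
    apply locally_2d_impl, locally_2d_forall; intros u v [H1 H2].
    apply continuity_2d_pt_plus; assumption.
  - assert (Hfg := locally_2d_and _ _ _ _ (Ck_ex_derive_loc _ _ _ _ Hf)
                     (Ck_ex_derive_loc _ _ _ _ Hg)).
    apply Ck_S; split; [| split].
    + revert Hfg; apply locally_2d_impl, locally_2d_forall.
      intros u v [(H1 & H2 & H3) (H4 & H5 & H6)]; split; [| split].
      * apply continuity_2d_pt_plus; assumption.
      * apply @ex_derive_plus; assumption.
      * apply @ex_derive_plus; assumption.
    + apply Ck_ext_loc with (fun u v => Du f u v + Du g u v).
      * revert Hfg; apply locally_2d_impl, locally_2d_forall.
        intros u v [(H1 & H2 & H3) (H4 & H5 & H6)]; unfold Du.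
        rewrite Derive_plus; auto.
      * apply IH; apply Ck_Du; assumption.
    + apply Ck_ext_loc with (fun u v => Dv f u v + Dv g u v).
      * revert Hfg; apply locally_2d_impl, locally_2d_forall.
        intros u v [(H1 & H2 & H3) (H4 & H5 & H6)]; unfold Dv.
        rewrite Derive_plus; auto.
      * apply IH; apply Ck_Dv; assumption.
Qed.

Lemma Ck_mult (n : nat) (f g : R -> R -> R) (x y : R) :
  Ck n f x y -> Ck n g x y -> Ck n (fun u v => f u v * g u v) x y.
Proof.
  revert f g; induction n as [|n IH]; intros f g Hf Hg.
  - apply Ck_0.
    generalize (locally_2d_and _ _ _ _ (Ck_continuous_loc _ _ _ _ Hf)
                  (Ck_continuous_loc _ _ _ _ Hg)).
    apply locally_2d_impl, locally_2d_forall; intros u v [H1 H2].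
    apply continuity_2d_pt_mult; assumption.
  - assert (Hfg := locally_2d_and _ _ _ _ (Ck_ex_derive_loc _ _ _ _ Hf)
                     (Ck_ex_derive_loc _ _ _ _ Hg)).
    assert (Hf' := Ck_le (S n) n f x y (Nat.le_succ_diag_r n) Hf).
    assert (Hg' := Ck_le (S n) n g x y (Nat.le_succ_diag_r n) Hg).
    apply Ck_S; split; [| split].
    + revert Hfg; apply locally_2d_impl, locally_2d_forall.
      intros u v [(H1 & H2 & H3) (H4 & H5 & H6)]; split; [| split].
      * apply continuity_2d_pt_mult; assumption.
      * apply (ex_derive_mult (fun t => f t v) (fun t => g t v)); assumption.
      * apply (ex_derive_mult (fun t => f u t) (fun t => g u t)); assumption.
    + apply Ck_ext_loc with (fun u v => Du f u v * g u v + f u v * Du g u v).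
      * revert Hfg; apply locally_2d_impl, locally_2d_forall.
        intros u v [(H1 & H2 & H3) (H4 & H5 & H6)]; unfold Du.
        rewrite Derive_mult; auto.
      * apply Ck_plus; apply IH; auto using Ck_Du.
    + apply Ck_ext_loc with (fun u v => Dv f u v * g u v + f u v * Dv g u v).
      * revert Hfg; apply locally_2d_impl, locally_2d_forall.
        intros u v [(H1 & H2 & H3) (H4 & H5 & H6)]; unfold Dv.
        rewrite Derive_mult; auto.
      * apply Ck_plus; apply IH; auto using Ck_Dv.
Qed.

Lemma Ck_opp (n : nat) (f : R -> R -> R) (x y : R) :
  Ck n f x y -> Ck n (fun u v => - f u v) x y.
Proof.
  intros Hf; apply Ck_ext with (fun u v => -1 * f u v); [intros; ring |].
  apply Ck_mult; [apply Ck_const | exact Hf].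
Qed.

Lemma Ck_minus (n : nat) (f g : R -> R -> R) (x y : R) :
  Ck n f x y -> Ck n g x y -> Ck n (fun u v => f u v - g u v) x y.
Proof.
  intros Hf Hg; apply (Ck_plus n f (fun u v => - g u v)); auto using Ck_opp.
Qed.

Lemma Ck_inv (n : nat) (f : R -> R -> R) (x y : R) :
  Ck n f x y -> f x y <> 0 -> Ck n (fun u v => / f u v) x y.
Proof.
  intros Hf Hne.
  assert (Hnz := continuity_2d_pt_neq_0 f x y (Ck_continuous n f x y Hf) Hne).
  revert Hf; induction n as [|n IH]; intros Hf.
  - apply Ck_0.
    generalize (locally_2d_and _ _ _ _ (Ck_continuous_loc _ _ _ _ Hf) Hnz).
    apply locally_2d_impl, locally_2d_forall; intros u v [H1 H2].
    apply continuity_2d_pt_inv; assumption.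
  - assert (Hfg := locally_2d_and _ _ _ _ (Ck_ex_derive_loc _ _ _ _ Hf) Hnz).
    assert (Hi := IH (Ck_le (S n) n f x y (Nat.le_succ_diag_r n) Hf)).
    apply Ck_S; split; [| split].
    + revert Hfg; apply locally_2d_impl, locally_2d_forall.
      intros u v [(H1 & H2 & H3) H4]; split; [| split].
      * apply continuity_2d_pt_inv; assumption.
      * apply (ex_derive_inv (fun t => f t v)); assumption.
      * apply (ex_derive_inv (fun t => f u t)); assumption.
    + apply Ck_ext_loc with (fun u v => - (Du f u v * (/ f u v * / f u v))).
      * revert Hfg; apply locally_2d_impl, locally_2d_forall.
        intros u v [(H1 & H2 & H3) H4]; unfold Du.
        rewrite Derive_inv by assumption; field; assumption.
      * apply Ck_opp; repeat apply Ck_mult; auto using Ck_Du.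
    + apply Ck_ext_loc with (fun u v => - (Dv f u v * (/ f u v * / f u v))).
      * revert Hfg; apply locally_2d_impl, locally_2d_forall.
        intros u v [(H1 & H2 & H3) H4]; unfold Dv.
        rewrite (Derive_inv (fun t => f u t)) by assumption; cbv beta; field; assumption.
      * apply Ck_opp; repeat apply Ck_mult; auto using Ck_Dv.
Qed.

Lemma Ck_div (n : nat) (f g : R -> R -> R) (x y : R) :
  Ck n f x y -> Ck n g x y -> g x y <> 0 -> Ck n (fun u v => f u v / g u v) x y.
Proof.
  intros Hf Hg Hne; apply (Ck_mult n f (fun u v => / g u v)); auto using Ck_inv.
Qed.

Lemma is_derive_sqrt_comp (g : R -> R) (x : R) :
  ex_derive g x -> 0 < g x ->
  is_derive (fun t => sqrt (g t)) x (Derive g x * / (2 * sqrt (g x))).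
Proof.
  intros Hg Hpos.
  apply (is_derive_comp sqrt g x (/ (2 * sqrt (g x))) (Derive g x)).
  - apply is_derive_Reals, derivable_pt_lim_sqrt, Hpos.
  - apply Derive_correct, Hg.
Qed.

Lemma Ck_sqrt (n : nat) (f : R -> R -> R) (x y : R) :
  Ck n f x y -> 0 < f x y -> Ck n (fun u v => sqrt (f u v)) x y.
Proof.
  intros Hf Hp.
  assert (Hpos : locally_2d (fun u v => 0 < f u v) x y).
  { destruct (Ck_continuous n f x y Hf (mkposreal _ Hp)) as [d Hd].
    exists d; intros u v Hu Hv; specialize (Hd u v Hu Hv); simpl in Hd.
    apply Rabs_def2 in Hd; lra. }
  revert Hf; induction n as [|n IH]; intros Hf.
  - apply Ck_0.
    generalize (locally_2d_and _ _ _ _ (Ck_continuous_loc _ _ _ _ Hf) Hpos).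
    apply locally_2d_impl, locally_2d_forall; intros u v [H1 H2].
    apply (continuity_1d_2d_pt_comp sqrt f); auto.
    apply continuity_pt_sqrt; lra.
  - assert (Hfg := locally_2d_and _ _ _ _ (Ck_ex_derive_loc _ _ _ _ Hf) Hpos).
    assert (Hi := IH (Ck_le (S n) n f x y (Nat.le_succ_diag_r n) Hf)).
    assert (Hi2 : Ck n (fun u v => / (2 * sqrt (f u v))) x y).
    { apply (Ck_inv n (fun u v => 2 * sqrt (f u v))).
      - apply (Ck_mult n (fun _ _ => 2)); auto using Ck_const.
      - generalize (sqrt_lt_R0 _ Hp); lra. }
    apply Ck_S; split; [| split].
    + revert Hfg; apply locally_2d_impl, locally_2d_forall.
      intros u v [(H1 & H2 & H3) H4]; split; [| split].
      * apply (continuity_1d_2d_pt_comp sqrt f); auto.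
        apply continuity_pt_sqrt; lra.
      * eexists; apply (is_derive_sqrt_comp (fun t => f t v)); assumption.
      * eexists; apply (is_derive_sqrt_comp (fun t => f u t)); assumption.
    + apply Ck_ext_loc with (fun u v => Du f u v * / (2 * sqrt (f u v))).
      * revert Hfg; apply locally_2d_impl, locally_2d_forall.
        intros u v [(H1 & H2 & H3) H4]; symmetry; apply is_derive_unique.
        apply (is_derive_sqrt_comp (fun t => f t v)); assumption.
      * apply Ck_mult; auto using Ck_Du.
    + apply Ck_ext_loc with (fun u v => Dv f u v * / (2 * sqrt (f u v))).
      * revert Hfg; apply locally_2d_impl, locally_2d_forall.
        intros u v [(H1 & H2 & H3) H4]; symmetry; apply is_derive_unique.
        apply (is_derive_sqrt_comp (fun t => f u t)); assumption.
      * apply Ck_mult; auto using Ck_Dv.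
Qed.

Lemma Ck_symmetric (f : R -> R -> R) (x y : R) :
  Ck 2 f x y -> Du (Dv f) x y = Dv (Du f) x y.
Proof.
  intros H; apply Schwarz.
  - assert (H1 := Ck_ex_derive_loc _ _ _ _ H).
    assert (H2 := Ck_ex_derive_loc _ _ _ _ (Ck_Du _ _ _ _ H)).
    assert (H3 := Ck_ex_derive_loc _ _ _ _ (Ck_Dv _ _ _ _ H)).
    generalize (locally_2d_and _ _ _ _ H1 (locally_2d_and _ _ _ _ H2 H3)).
    apply locally_2d_impl, locally_2d_forall.
    intros u v ((_ & A & B) & (_ & _ & C) & (_ & D & _)); auto.
  - apply (Ck_continuous 0), (Ck_Du 0), Ck_Dv, H.
  - apply (Ck_continuous 0), (Ck_Dv 0), Ck_Du, H.
Qed.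

(** * Derivatives and continuity in one variable *)

Lemma der_eq (f : R -> R) (x l l' : R) : is_derive f x l -> l = l' -> is_derive f x l'.
Proof. intros H <-; exact H. Qed.

Lemma der_plus (f g : R -> R) (x a b : R) :
  is_derive f x a -> is_derive g x b -> is_derive (fun t => f t + g t) x (a + b).
Proof. intros Hf Hg; apply @is_derive_plus; assumption. Qed.

Lemma der_mult (f g : R -> R) (x a b : R) :
  is_derive f x a -> is_derive g x b ->
  is_derive (fun t => f t * g t) x (a * g x + f x * b).
Proof. intros Hf Hg; apply is_derive_Reals, derivable_pt_lim_mult; apply is_derive_Reals; assumption. Qed.

Lemma der_const (c x : R) : is_derive (fun _ => c) x 0.
Proof. apply @is_derive_const. Qed.

Lemma der_opp (f : R -> R) (x a : R) :
  is_derive f x a -> is_derive (fun t => - f t) x (- a).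
Proof. intros Hf; apply @is_derive_opp; assumption. Qed.

Lemma der_minus (f g : R -> R) (x a b : R) :
  is_derive f x a -> is_derive g x b -> is_derive (fun t => f t - g t) x (a - b).
Proof. intros Hf Hg; apply @is_derive_minus; assumption. Qed.

Lemma der_div (f g : R -> R) (x a b : R) :
  is_derive f x a -> is_derive g x b -> g x <> 0 ->
  is_derive (fun t => f t / g t) x ((a * g x - f x * b) / g x ^ 2).
Proof. apply is_derive_div. Qed.

Lemma der_continuous (f : R -> R) (x l : R) : is_derive f x l -> continuity_pt f x.
Proof.
  intros H; apply derivable_continuous_pt; exists l; apply is_derive_Reals, H.
Qed.

Ltac der_step :=
  cbv beta;
  match goal with
  | H : is_derive ?f ?x _ |- is_derive ?f ?x _ => exact H
  | H : is_derive ?f ?x _ |- is_derive (fun t => ?f t) ?x _ => exact H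
  | |- is_derive (fun _ => ?c) _ _ => exact (der_const c _)
  | |- is_derive (fun t => @?f t + @?g t) ?x _ => eapply (der_plus f g x)
  | |- is_derive (fun t => @?f t - @?g t) ?x _ => eapply (der_minus f g x)
  | |- is_derive (fun t => @?f t / @?g t) ?x _ => eapply (der_div f g x)
  | |- is_derive (fun t => @?f t * @?g t) ?x _ => eapply (der_mult f g x)
  | |- is_derive (fun t => - @?f t) ?x _ => eapply (der_opp f x)
  end.

Ltac der := eapply der_eq; [repeat der_step |].

Lemma cont_plus (f g : R -> R) (x : R) :
  continuity_pt f x -> continuity_pt g x -> continuity_pt (fun t => f t + g t) x.
Proof. apply continuity_pt_plus. Qed.
Lemma cont_minus (f g : R -> R) (x : R) :
  continuity_pt f x -> continuity_pt g x -> continuity_pt (fun t => f t - g t) x.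
Proof. apply continuity_pt_minus. Qed.
Lemma cont_mult (f g : R -> R) (x : R) :
  continuity_pt f x -> continuity_pt g x -> continuity_pt (fun t => f t * g t) x.
Proof. apply continuity_pt_mult. Qed.
Lemma cont_opp (f : R -> R) (x : R) :
  continuity_pt f x -> continuity_pt (fun t => - f t) x.
Proof. apply continuity_pt_opp. Qed.
Lemma cont_div (f g : R -> R) (x : R) :
  continuity_pt f x -> continuity_pt g x -> g x <> 0 ->
  continuity_pt (fun t => f t / g t) x.
Proof. apply continuity_pt_div. Qed.
Lemma cont_const (c x : R) : continuity_pt (fun _ => c) x.
Proof. apply continuity_pt_const; intros ? ?; reflexivity. Qed.

Ltac cont :=
  repeat (cbv beta; match goal with
  | H : continuity_pt ?f ?x |- continuity_pt ?f ?x => exact H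
  | H : continuity_pt ?f ?x |- continuity_pt (fun t => ?f t) ?x => exact H
  | |- continuity_pt (fun _ => ?c) _ => exact (cont_const c _)
  | |- continuity_pt (fun t => @?f t + @?g t) ?x => apply (cont_plus f g x)
  | |- continuity_pt (fun t => @?f t - @?g t) ?x => apply (cont_minus f g x)
  | |- continuity_pt (fun t => @?f t / @?g t) ?x => apply (cont_div f g x)
  | |- continuity_pt (fun t => @?f t * @?g t) ?x => apply (cont_mult f g x)
  | |- continuity_pt (fun t => - @?f t) ?x => apply (cont_opp f x)
  end); auto.

(** * Uniqueness for the radial equation *)

Lemma mean_value_open (f df : R -> R) (a b : R) :
  a < b ->
  (forall x, a < x < b -> is_derive f x (df x)) ->
  (forall x, a <= x <= b -> continuity_pt f x) ->
  exists c, a < c < b /\ f b - f a = df c * (b - a).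
Proof.
  intros Hab Hd Hc.
  assert (pr1 : forall c, a < c < b -> derivable_pt f c).
  { intros c Hc'; exists (df c); apply is_derive_Reals, Hd, Hc'. }
  destruct (MVT f id a b pr1 (fun c _ => derivable_pt_id c) Hab Hc) as (c & P & E).
  { intros c _; apply derivable_continuous_pt, derivable_pt_id. }
  exists c; split; [exact P |].
  rewrite derive_pt_id in E.
  rewrite (derive_pt_eq_0 f c (df c)) in E by apply is_derive_Reals, Hd, P.
  unfold id in E; lra.
Qed.

Lemma increment_bound (f df : R -> R) (a b M : R) :
  a <= b ->
  (forall x, a < x < b -> is_derive f x (df x)) ->
  (forall x, a <= x <= b -> continuity_pt f x) ->
  (forall x, a < x < b -> Rabs (df x) <= M) ->
  Rabs (f b - f a) <= M * (b - a).
Proof.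
  intros [Hab | <-] Hd Hc HM.
  - destruct (mean_value_open f df a b Hab Hd Hc) as (c & P & ->).
    rewrite Rabs_mult, (Rabs_right (b - a)) by lra.
    apply Rmult_le_compat_r; [lra | auto].
  - rewrite !Rminus_diag, Rabs_R0; lra.
Qed.

(** On a short interval the equations, integrated twice, bound the maximum of
    |W| by a quarter of itself. *)
Lemma singular_ode_step (W P k l : R -> R) (a b d M : R) :
  0 <= a <= b -> b - a <= d -> M * d <= 1 / 2 -> 0 <= M ->
  (forall s, a <= s <= b -> continuity_pt W s) ->
  (forall s, a <= s <= b -> continuity_pt P s) ->
  W a = 0 -> P a = 0 ->
  (forall s, a < s < b -> is_derive W s (k s * (P s / s))) ->
  (forall s, a < s < b -> is_derive P s (s * (l s * W s))) ->
  (forall s, a < s < b -> Rabs (k s) <= M) ->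
  (forall s, a < s < b -> Rabs (l s) <= M) ->
  forall s, a <= s <= b -> W s = 0 /\ P s = 0.
Proof.
  intros Hab Hd HMd HM HcW HcP HW0 HP0 HW HP Hk Hl.
  destruct (continuity_ab_maj (fun s => Rabs (W s)) a b) as (x & Hmax & Hx).
  { lra. }
  { intros c Hc; apply (continuity_pt_comp W Rabs); [auto |].
    apply Rcontinuity_abs. }
  set (N := Rabs (W x)) in *.
  assert (HN : 0 <= N) by apply Rabs_pos.
  assert (HPb : forall t, a <= t <= b -> Rabs (P t) <= t * (M * N) * (t - a)).
  { intros t Ht; rewrite <- (Rminus_0_r (P t)), <- HP0.
    apply increment_bound with (fun s => s * (l s * W s)); try (intros; auto with real).
    - lra.
    - apply HP; lra.
    - apply HcP; lra.
    - rewrite !Rabs_mult, (Rabs_right x0) by lra.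
      assert (Rabs (l x0) * Rabs (W x0) <= M * N).
      { apply Rmult_le_compat; try apply Rabs_pos; [apply Hl | apply Hmax]; lra. }
      assert (0 <= Rabs (l x0) * Rabs (W x0))
        by (apply Rmult_le_pos; apply Rabs_pos).
      apply Rmult_le_compat; lra. }
  assert (HWb : forall t, a <= t <= b -> Rabs (W t) <= M * (M * N * d) * (t - a)).
  { intros t Ht; rewrite <- (Rminus_0_r (W t)), <- HW0.
    apply increment_bound with (fun s => k s * (P s / s)); try (intros; auto with real).
    - lra.
    - apply HW; lra.
    - apply HcW; lra.
    - rewrite Rabs_mult.
      apply Rmult_le_compat; try apply Rabs_pos; [apply Hk; lra |].
      unfold Rdiv; rewrite Rabs_mult, Rabs_inv, (Rabs_right x0) by lra.
      apply Rmult_le_reg_r with x0; [lra |].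
      rewrite Rmult_assoc, Rinv_l, Rmult_1_r by lra.
      apply Rle_trans with (1 := HPb x0 ltac:(lra)).
      replace (M * N * d * x0) with (x0 * (M * N) * d) by ring.
      apply Rmult_le_compat_l; [| lra].
      apply Rmult_le_pos; [lra | apply Rmult_le_pos; lra]. }
  assert (HN0 : N = 0).
  { assert (H1 : N <= M * (M * N * d) * (x - a)) by apply (HWb x Hx).
    assert (H2 : M * (M * N * d) * (x - a) <= M * (M * N * d) * d).
    { apply Rmult_le_compat_l; [| lra].
      repeat apply Rmult_le_pos; lra. }
    assert (H3 : (M * d) * (M * d) <= 1 / 2 * (1 / 2)).
    { apply Rmult_le_compat; try lra; apply Rmult_le_pos; lra. }
    nra. }
  intros s Hs; split.
  - specialize (Hmax s Hs); rewrite HN0 in Hmax.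
    destruct (Req_dec (W s) 0) as [E | E]; [exact E |].
    apply Rabs_pos_lt in E; lra.
  - specialize (HPb s Hs); rewrite HN0 in HPb.
    destruct (Req_dec (P s) 0) as [E | E]; [exact E |].
    apply Rabs_pos_lt in E.
    replace (s * (M * 0) * (s - a)) with 0 in HPb by ring; lra.
Qed.

(** Although [1 / s] is not integrable, the Cauchy problem at [s = 0] has only
    the zero solution: the factor [s] in the second equation makes [P s / s]
    as small as [W].  So intervals of a fixed length can be crossed one after
    another, starting from the singular point. *)
Lemma singular_ode_unique (W P k l : R -> R) (b M : R) :
  0 <= b ->
  (forall s, 0 <= s <= b -> continuity_pt W s) ->
  (forall s, 0 <= s <= b -> continuity_pt P s) ->
  W 0 = 0 -> P 0 = 0 ->
  (forall s, 0 < s < b -> is_derive W s (k s * (P s / s))) ->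
  (forall s, 0 < s < b -> is_derive P s (s * (l s * W s))) ->
  (forall s, 0 < s < b -> Rabs (k s) <= M) ->
  (forall s, 0 < s < b -> Rabs (l s) <= M) ->
  forall s, 0 <= s <= b -> W s = 0.
Proof.
  intros Hb HcW HcP HW0 HP0 HW HP Hk Hl.
  set (M' := Rmax M 1).
  assert (HM' : 1 <= M') by apply Rmax_r.
  assert (HMM : M <= M') by apply Rmax_l.
  set (d := / (2 * M')).
  assert (Hd : 0 < d) by (apply Rinv_0_lt_compat; lra).
  assert (HMd : M' * d = 1 / 2) by (unfold d; field; lra).
  assert (Hn : forall n s, 0 <= s <= b -> s <= INR n * d -> W s = 0 /\ P s = 0).
  { induction n as [|n IH]; intros s Hs Hsn.
    - simpl in Hsn; replace s with 0 by lra; auto.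
    - destruct (Rle_dec s (INR n * d)) as [H | H]; [auto |].
      rewrite S_INR in Hsn.
      assert (Hpos : 0 <= INR n * d) by (apply Rmult_le_pos; [apply pos_INR | lra]).
      destruct (IH (INR n * d)) as [EW EP]; [lra | lra |].
      apply (singular_ode_step W P k l (INR n * d) s d M'); try lra.
      + intros t Ht; apply HcW; lra.
      + intros t Ht; apply HcP; lra.
      + intros t Ht; apply HW; lra.
      + intros t Ht; apply HP; lra.
      + intros t Ht; apply Rle_trans with M; [apply Hk |]; lra.
      + intros t Ht; apply Rle_trans with M; [apply Hl |]; lra. }
  intros s Hs.
  destruct (INR_unbounded (s / d)) as [n Hsn].
  apply (Hn n s Hs).
  apply Rmult_lt_compat_r with (r := d) in Hsn; [| exact Hd].
  unfold Rdiv in Hsn; rewrite Rmult_assoc, Rinv_l in Hsn; lra.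
Qed.

(** Identities are proved away from the centre, where polar coordinates are
    singular, and from the boundary, beyond which the symmetry is unknown; this
    extends them. *)
Lemma zero_on_closure (g : R -> R) :
  (forall s, 0 <= s <= 1 -> continuity_pt g s) ->
  (forall s, 0 < s < 1 -> g s = 0) ->
  forall s, 0 <= s <= 1 -> g s = 0.
Proof.
  intros Hc H0 s Hs.
  destruct (Req_dec (g s) 0) as [E | E]; [exact E | exfalso].
  apply Rabs_pos_lt in E.
  destruct (Hc s Hs (Rabs (g s)) E) as (d & Hd & H).
  set (t := if Rle_dec s (1 / 2) then s + Rmin (d / 2) (1 / 4)
            else s - Rmin (d / 2) (1 / 4)).
  assert (Hm := Rmin_l (d / 2) (1 / 4)); assert (Hm' := Rmin_r (d / 2) (1 / 4)).
  assert (Hp : 0 < Rmin (d / 2) (1 / 4)) by (apply Rmin_glb_lt; lra).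
  assert (Ht : 0 < t < 1 /\ t <> s /\ Rabs (t - s) < d).
  { unfold t; destruct (Rle_dec s (1 / 2)); repeat split; try lra;
      unfold Rabs; destruct Rcase_abs; lra. }
  specialize (H t); rewrite (H0 t) in H by tauto.
  simpl in H; unfold R_dist in H.
  rewrite Rminus_0_l, Rabs_Ropp in H.
  assert (Rabs (g s) < Rabs (g s)); [apply H | lra].
  split; [split; [exact I | apply not_eq_sym; tauto] | tauto].
Qed.

Lemma continuous_bounded (g : R -> R) (a b : R) :
  a <= b -> (forall s, a <= s <= b -> continuity_pt g s) ->
  exists M, forall s, a <= s <= b -> Rabs (g s) <= M.
Proof.
  intros Hab Hc.
  destruct (continuity_ab_maj (fun s => Rabs (g s)) a b Hab) as (x & Hx & _).
  - intros c Hcc; apply (continuity_pt_comp g Rabs); [auto | apply Rcontinuity_abs].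
  - exists (Rabs (g x)); exact Hx.
Qed.

(** * The linearised equation along a profile curve *)

Set Implicit Arguments.
(** The structure equations of a critical profile (rho, zeta) on [0, 1], with
    tangent direction (C, S) and signed speed v, the normal of the surface being
    (- S, C) in the half-plane of the profile.  The principal curvatures are
    S / rho, along the parallels, and 2 F - S / rho, along the meridians, so that
    F is the mean and K the Gauss curvature; dF is the derivative of F. *)
Record profile_eqs (c0 : R) (rho zeta v C S F dF K : R -> R) : Prop := {
  pe_rho0 : rho 0 = 0;
  pe_S0 : S 0 = 0;
  pe_v0 : v 0 <> 0;
  pe_drho0 : exists d0, d0 <> 0 /\ is_derive rho 0 d0;
  pe_crho : forall s, 0 <= s <= 1 -> continuity_pt rho s;
  pe_czeta : forall s, 0 <= s <= 1 -> continuity_pt zeta s;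
  pe_cC : forall s, 0 <= s <= 1 -> continuity_pt C s;
  pe_cS : forall s, 0 <= s <= 1 -> continuity_pt S s;
  pe_cF : forall s, 0 <= s <= 1 -> continuity_pt F s;
  pe_cv : forall s, 0 <= s < 1 -> continuity_pt v s;
  pe_cdF : forall s, 0 <= s < 1 -> continuity_pt dF s;
  pe_cK : forall s, 0 <= s < 1 -> continuity_pt K s;
  pe_rho : forall s, 0 < s <= 1 -> rho s <> 0;
  pe_v : forall s, 0 < s < 1 -> v s <> 0;
  pe_unit : forall s, 0 < s < 1 -> C s * C s + S s * S s = 1;
  pe_drho : forall s, 0 < s < 1 -> is_derive rho s (v s * C s);
  pe_dzeta : forall s, 0 < s < 1 -> is_derive zeta s (v s * S s);
  pe_dC : forall s, 0 < s < 1 ->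
    is_derive C s (- (v s * (2 * F s - S s / rho s) * S s));
  pe_dS : forall s, 0 < s < 1 ->
    is_derive S s (v s * (2 * F s - S s / rho s) * C s);
  pe_K : forall s, 0 < s < 1 ->
    K s = (2 * F s - S s / rho s) * (S s / rho s);
  pe_dF : forall s, 0 < s < 1 -> is_derive F s (dF s);
  pe_EL : forall s, 0 < s < 1 ->
    is_derive (fun s => rho s / v s * dF s) s
      (- (rho s * v s * (2 * (F s + c0) * (F s * (F s - c0) - K s))))
}.

Unset Implicit Arguments.

(** Meant for f 0 = 0 and d the derivative of f at 0, so as to be continuous. *)
Definition quotient_at_0 (f : R -> R) (d s : R) : R :=
  if Req_EM_T s 0 then d else f s / s.

Lemma quotient_at_0_continuous (f : R -> R) (d s : R) :
  f 0 = 0 -> is_derive f 0 d -> continuity_pt f s ->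
  continuity_pt (quotient_at_0 f d) s.
Proof.
  intros H0 Hd Hc.
  destruct (Req_dec s 0) as [-> | Hs].
  - apply is_derive_Reals in Hd.
    apply continuity_pt_locally; intros eps.
    destruct (Hd eps (cond_pos eps)) as [del Hdel].
    exists del; intros t Ht.
    unfold quotient_at_0.
    destruct (Req_EM_T 0 0) as [_ | ]; [| lra].
    destruct (Req_EM_T t 0) as [-> | Hn].
    + rewrite Rminus_diag, Rabs_R0; apply cond_pos.
    + specialize (Hdel t Hn); rewrite H0, Rplus_0_l, Rminus_0_r in Hdel.
      apply Hdel.
      change (Rabs (t - 0) < del) in Ht; rewrite Rminus_0_r in Ht; exact Ht.
  - apply continuity_pt_ext_loc with (fun t => f t / t).
    + assert (Hp : 0 < Rabs s) by (apply Rabs_pos_lt; exact Hs).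
      exists (mkposreal _ Hp); intros t Ht.
      unfold quotient_at_0; destruct (Req_EM_T t 0) as [-> | ]; [| reflexivity].
      change (Rabs (0 - s) < Rabs s) in Ht.
      rewrite Rminus_0_l, Rabs_Ropp in Ht; lra.
    + apply cont_div; auto.
      apply derivable_continuous_pt, derivable_pt_id.
Qed.

(** With f = F + c0, the functions w = l (C + f zeta) + m f all solve the
    linear equation that criticality expresses for f itself.  As a first
    order system for w and P = (rho / v) w' it is singular at the axis, but
    P, written without the curvature of the meridian, is continuous and
    vanishes there whatever the value of w. *)
Lemma profile_linear c0 rho zeta v C S F dF K (l m : R) :
  profile_eqs c0 rho zeta v C S F dF K ->
  l * (C 0 + (F 0 + c0) * zeta 0) + m * (F 0 + c0) = 0 ->
  forall s, 0 <= s <= 1 ->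
  l * (C s + (F s + c0) * zeta s) + m * (F s + c0) = 0.
Proof.
  intros HE Hw0.
  apply zero_on_closure.
  { intros s Hs; pose proof (pe_cC HE Hs).
    pose proof (pe_cF HE Hs).
    pose proof (pe_czeta HE Hs); cont. }
  intros b Hb.
  destruct (pe_drho0 HE) as (d0 & Hd0 & Hdr).
  assert (Hr0 := pe_rho0 HE).
  assert (Hrr : forall s, 0 <= s <= b -> quotient_at_0 rho d0 s <> 0).
  { intros s Hs; unfold quotient_at_0; destruct (Req_EM_T s 0); [exact Hd0 |].
    apply Rmult_integral_contrapositive_currified.
    - apply (pe_rho HE); lra.
    - apply Rinv_neq_0_compat; assumption. }
  assert (Hcrr : forall s, 0 <= s <= b -> continuity_pt (quotient_at_0 rho d0) s).
  { intros s Hs; apply quotient_at_0_continuous; auto.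
    apply (pe_crho HE); lra. }
  assert (Hv : forall s, 0 <= s <= b -> v s <> 0).
  { intros s Hs; destruct (Req_dec s 0) as [-> | ].
    - apply (pe_v0 HE).
    - apply (pe_v HE); lra. }
  set (k := fun s => v s / quotient_at_0 rho d0 s).
  set (q := fun s => - (quotient_at_0 rho d0 s * v s *
                        (2 * (F s * (F s - c0) - K s)))).
  destruct (continuous_bounded k 0 b) as [M1 HM1]; [lra | |].
  { intros s Hs; apply cont_div; auto.
    apply (pe_cv HE); lra. }
  destruct (continuous_bounded q 0 b) as [M2 HM2]; [lra | |].
  { intros s Hs; unfold q.
    assert (continuity_pt F s) by (apply (pe_cF HE); lra).
    assert (continuity_pt K s) by (apply (pe_cK HE); lra).
    assert (continuity_pt v s) by (apply (pe_cv HE); lra).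
    cont. }
  set (P := fun s => rho s / v s * dF s * (l * zeta s + m)
                     + l * (rho s * (S s * (c0 - F s)) + S s * S s)).
  apply (singular_ode_unique
    (fun s => l * (C s + (F s + c0) * zeta s) + m * (F s + c0))
    P k q b (Rmax M1 M2)).
  - lra.
  - intros s Hs.
    assert (continuity_pt F s) by (apply (pe_cF HE); lra).
    assert (continuity_pt C s) by (apply (pe_cC HE); lra).
    assert (continuity_pt zeta s) by (apply (pe_czeta HE); lra).
    cont.
  - intros s Hs; unfold P.
    assert (continuity_pt F s) by (apply (pe_cF HE); lra).
    assert (continuity_pt S s) by (apply (pe_cS HE); lra).
    assert (continuity_pt rho s) by (apply (pe_crho HE); lra).
    assert (continuity_pt dF s) by (apply (pe_cdF HE); lra).
    assert (continuity_pt v s) by (apply (pe_cv HE); lra).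
    assert (continuity_pt zeta s) by (apply (pe_czeta HE); lra).
    specialize (Hv s Hs); cont.
  - exact Hw0.
  - unfold P; rewrite (pe_S0 HE), Hr0; unfold Rdiv; ring.
  - intros s Hs.
    assert (Hs1 : 0 < s < 1) by lra.
    pose proof (pe_dC HE Hs1).
    pose proof (pe_dF HE Hs1).
    pose proof (pe_dzeta HE Hs1).
    assert (rho s <> 0) by (apply (pe_rho HE); lra).
    specialize (Hv s ltac:(lra)).
    der; cbv beta; unfold k, P, quotient_at_0.
    destruct (Req_EM_T s 0); [lra |].
    field; auto.
  - intros s Hs.
    assert (Hs1 : 0 < s < 1) by lra.
    pose proof (pe_dS HE Hs1).
    pose proof (pe_dF HE Hs1).
    pose proof (pe_EL HE Hs1).
    pose proof (pe_dzeta HE Hs1).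
    pose proof (pe_drho HE Hs1).
    assert (rho s <> 0) by (apply (pe_rho HE); lra).
    specialize (Hv s ltac:(lra)).
    assert (E : is_derive P s (- (rho s * v s * (2 * (F s + c0) * (F s * (F s - c0) - K s)))
         * (l * zeta s + m)
       + rho s / v s * dF s * (l * (v s * S s))
       + l * ((v s * C s) * (S s * (c0 - F s))
              + rho s * ((v s * (2 * F s - S s / rho s) * C s) * (c0 - F s)
                         - S s * dF s)
              + 2 * S s * (v s * (2 * F s - S s / rho s) * C s)))).
    { unfold P. der. cbv beta; ring. }
    apply (der_eq _ _ _ _ E).
    unfold q, quotient_at_0.
    destruct (Req_EM_T s 0); [lra |].
    rewrite (pe_K HE Hs1).
    field; auto.
  - intros s Hs; apply Rle_trans with (2 := Rmax_l _ _), HM1; lra.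
  - intros s Hs; apply Rle_trans with (2 := Rmax_r _ _), HM2; lra.
  - lra.
Qed.

(** * Profiles of constant mean curvature *)

Lemma constant_on_unit_interval (g : R -> R) :
  (forall s, 0 <= s <= 1 -> continuity_pt g s) ->
  (forall s, 0 < s < 1 -> is_derive g s 0) ->
  forall s, 0 <= s <= 1 -> g s = g 0.
Proof.
  intros Hc Hd s Hs.
  assert (H : Rabs (g s - g 0) <= 0 * (s - 0)).
  { apply increment_bound with (fun _ => 0); [lra | | |].
    - intros x Hx; apply Hd; lra.
    - intros x Hx; apply Hc; lra.
    - intros x Hx; rewrite Rabs_R0; lra. }
  destruct (Req_dec (g s - g 0) 0) as [E | E]; [lra |].
  apply Rabs_pos_lt in E; lra.
Qed.

Lemma nonzero_derivative_injective (g dg : R -> R) :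
  (forall s, 0 <= s <= 1 -> continuity_pt g s) ->
  (forall s, 0 < s < 1 -> is_derive g s (dg s)) ->
  (forall s, 0 < s < 1 -> dg s <> 0) ->
  forall s s', 0 <= s <= 1 -> 0 <= s' <= 1 -> g s = g s' -> s = s'.
Proof.
  intros Hc Hd Hn.
  assert (Hlt : forall s s', 0 <= s -> s < s' -> s' <= 1 -> g s = g s' -> False).
  { intros s s' H0 Hss H1 E.
    destruct (mean_value_open g dg s s' Hss) as (c & Hcc & Ec).
    - intros x Hx; apply Hd; lra.
    - intros x Hx; apply Hc; lra.
    - rewrite E, Rminus_diag in Ec; symmetry in Ec.
      apply Rmult_integral in Ec; destruct Ec as [Ec | Ec]; [| lra].
      apply (Hn c); [lra | exact Ec]. }
  intros s s' Hs Hs' E.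
  destruct (Rtotal_order s s') as [H | [H | H]]; [exfalso | exact H | exfalso].
  - apply (Hlt s s'); lra.
  - apply (Hlt s' s); lra.
Qed.

Lemma intermediate_value (g : R -> R) (a b y : R) :
  a <= b -> (forall s, a <= s <= b -> continuity_pt g s) ->
  g a <= y <= g b -> exists s, a <= s <= b /\ g s = y.
Proof.
  intros Hab Hc Hy.
  destruct (Req_dec (g a) y) as [E | Ea]; [exists a; split; [lra | exact E] |].
  destruct (Req_dec (g b) y) as [E | Eb]; [exists b; split; [lra | exact E] |].
  destruct (Req_dec a b) as [-> | Hne]; [lra |].
  destruct (IVT_interv (fun s => g s - y) a b) as (z & Hz & E); try lra.
  - intros s Hs; specialize (Hc s Hs); cont.
  - exists z; split; [exact Hz | lra].
Qed.

(** An intermediate value argument in place of monotonicity: it spares the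
    discussion of the sign of the derivative. *)
Lemma injective_between (g : R -> R) :
  (forall s, 0 <= s <= 1 -> continuity_pt g s) ->
  (forall s s', 0 <= s <= 1 -> 0 <= s' <= 1 -> g s = g s' -> s = s') ->
  g 0 < g 1 -> forall s, 0 <= s <= 1 -> g 0 <= g s <= g 1.
Proof.
  intros Hc Hi H01 s Hs; split; apply Rnot_lt_le; intros H.
  - destruct (intermediate_value g s 1 (g 0)) as (z & Hz & E); try lra.
    + intros x Hx; apply Hc; lra.
    + assert (z = 0) by (apply Hi; lra).
      assert (s = 0) by lra; subst s; lra.
  - destruct (intermediate_value g 0 s (g 1)) as (z & Hz & E); try lra.
    + intros x Hx; apply Hc; lra.
    + assert (z = 1) by (apply Hi; lra).
      assert (s = 1) by lra; subst s; lra.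
Qed.

(** The first integral [rho S = H rho^2 + const] of surfaces of revolution of
    constant mean curvature [H]; the constant vanishes because the profile meets
    the axis. *)
Lemma cmc_profile c0 rho zeta v C S F dF K :
  profile_eqs c0 rho zeta v C S F dF K ->
  (forall s, 0 <= s <= 1 -> F s = - c0) ->
  forall s, 0 <= s <= 1 -> S s = - c0 * rho s.
Proof.
  intros HE HF s Hs.
  assert (E : rho s * S s + c0 * (rho s * rho s) = rho 0 * S 0 + c0 * (rho 0 * rho 0)).
  { apply (constant_on_unit_interval (fun s => rho s * S s + c0 * (rho s * rho s)));
      [| | exact Hs].
    - intros x Hx; pose proof (pe_crho HE Hx); pose proof (pe_cS HE Hx); cont.
    - intros x Hx; pose proof (pe_drho HE Hx); pose proof (pe_dS HE Hx).
      assert (rho x <> 0) by (apply (pe_rho HE); lra).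
      der; rewrite (HF x) by lra; field; assumption. }
  rewrite (pe_rho0 HE) in E.
  destruct (Req_dec s 0) as [-> | Hne].
  - rewrite (pe_S0 HE), (pe_rho0 HE); ring.
  - apply Rmult_eq_reg_l with (rho s); [lra | apply (pe_rho HE); lra].
Qed.

(** The square of the radius parametrises the profile, whatever the sign of
    the radius. *)
Lemma planar_profile rho zeta v C S F dF K :
  profile_eqs 0 rho zeta v C S F dF K ->
  (forall s, 0 <= s <= 1 -> F s = - 0) ->
  (forall s, 0 <= s <= 1 -> zeta s = zeta 0) /\
  (forall s s', 0 <= s <= 1 -> 0 <= s' <= 1 -> rho s * rho s = rho s' * rho s' -> s = s').
Proof.
  intros HE HF.
  assert (HS : forall s, 0 <= s <= 1 -> S s = 0).
  { intros s Hs; rewrite (cmc_profile _ _ _ _ _ _ _ _ _ HE HF s Hs); ring. }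
  split.
  - apply constant_on_unit_interval; [apply (pe_czeta HE) |].
    intros s Hs; eapply der_eq; [apply (pe_dzeta HE Hs) |].
    rewrite HS by lra; ring.
  - apply (nonzero_derivative_injective _ (fun s => 2 * rho s * (v s * C s))).
    + intros s Hs; pose proof (pe_crho HE Hs); cont.
    + intros s Hs; pose proof (pe_drho HE Hs); der; ring.
    + intros s Hs E.
      assert (Hr : rho s <> 0) by (apply (pe_rho HE); lra).
      assert (Hv := pe_v HE Hs).
      assert (U := pe_unit HE Hs); rewrite HS in U by lra.
      apply Rmult_integral in E; destruct E as [E | E]; [lra |].
      apply Rmult_integral in E; destruct E as [E | E]; [auto | rewrite E in U; lra].
Qed.

(** With S = - c0 rho, the combination C - c0 zeta is constant, so the unit
    vector (C, S) is - c0 times the rotated position relative to the point k of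
    the axis. *)
Lemma spherical_profile c0 rho zeta v C S F dF K :
  c0 <> 0 -> profile_eqs c0 rho zeta v C S F dF K ->
  (forall s, 0 <= s <= 1 -> F s = - c0) ->
  exists k,
    (forall s, 0 <= s <= 1 ->
       rho s * rho s + (zeta s - k) * (zeta s - k) = / Rabs c0 * / Rabs c0) /\
    (forall s s', 0 <= s <= 1 -> 0 <= s' <= 1 -> zeta s = zeta s' -> s = s').
Proof.
  intros Hc0 HE HF.
  assert (HS := cmc_profile _ _ _ _ _ _ _ _ _ HE HF).
  exists (zeta 0 - C 0 / c0); split.
  - intros s Hs.
    assert (EC : C s - c0 * zeta s = C 0 - c0 * zeta 0).
    { apply (constant_on_unit_interval (fun s => C s - c0 * zeta s)); [| | exact Hs].
      - intros x Hx; pose proof (pe_cC HE Hx); pose proof (pe_czeta HE Hx); cont.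
      - intros x Hx; pose proof (pe_dC HE Hx); pose proof (pe_dzeta HE Hx).
        assert (rho x <> 0) by (apply (pe_rho HE); lra).
        der; rewrite (HF x), (HS x) by lra; field; assumption. }
    assert (U : C s * C s + S s * S s - 1 = 0).
    { apply (zero_on_closure (fun s => C s * C s + S s * S s - 1)); [| | exact Hs].
      - intros x Hx; pose proof (pe_cC HE Hx); pose proof (pe_cS HE Hx); cont.
      - intros x Hx; rewrite (pe_unit HE Hx); ring. }
    rewrite <- Rinv_mult, <- Rabs_mult, Rabs_right by nra.
    replace (zeta s - (zeta 0 - C 0 / c0)) with (C s / c0)
      by (replace (C s) with (C 0 - c0 * zeta 0 + c0 * zeta s) by lra; field; exact Hc0).
    replace (rho s) with (- (S s / c0)) by (rewrite (HS s Hs); field; exact Hc0).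
    transitivity ((C s * C s + S s * S s) * / (c0 * c0)); [field; exact Hc0 |].
    replace (C s * C s + S s * S s) with 1 by lra; ring.
  - apply (nonzero_derivative_injective _ (fun s => v s * S s)).
    + apply (pe_czeta HE).
    + intros s Hs; apply (pe_dzeta HE Hs).
    + intros s Hs; rewrite HS by lra.
      assert (rho s <> 0) by (apply (pe_rho HE); lra).
      assert (Hv := pe_v HE Hs).
      repeat apply Rmult_integral_contrapositive_currified; auto.
      lra.
Qed.

Lemma norm3_le_iff (p : vec3) (a : R) : 0 <= a -> (norm3 p <= a <-> dot3 p p <= a * a).
Proof.
  intros Ha; unfold norm3.
  assert (Hp : 0 <= dot3 p p) by (unfold dot3; nra).
  assert (Hs := sqrt_pos (dot3 p p)); assert (Hq := sqrt_sqrt _ Hp).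
  split; intros H; nra.
Qed.

Lemma norm3_eq_iff (p : vec3) (a : R) : 0 <= a -> (norm3 p = a <-> dot3 p p = a * a).
Proof.
  intros Ha; unfold norm3.
  assert (Hp : 0 <= dot3 p p) by (unfold dot3; nra).
  assert (Hq := sqrt_sqrt _ Hp).
  split; intros H; [rewrite <- Hq, H; reflexivity |].
  rewrite H; apply sqrt_square, Ha.
Qed.

(** * Regularity of the geometric quantities *)

Ltac ck :=
  repeat (cbv beta; match goal with
  | H : Ck ?n ?f ?x ?y |- Ck ?n ?f ?x ?y => exact H
  | |- Ck _ (fun _ _ => ?c) _ _ => apply Ck_const
  | |- Ck ?n (fun u v => @?f u v + @?g u v) ?x ?y => apply (Ck_plus n f g x y)
  | |- Ck ?n (fun u v => @?f u v - @?g u v) ?x ?y => apply (Ck_minus n f g x y)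
  | |- Ck ?n (fun u v => @?f u v / @?g u v) ?x ?y => apply (Ck_div n f g x y)
  | |- Ck ?n (fun u v => @?f u v * @?g u v) ?x ?y => apply (Ck_mult n f g x y)
  | |- Ck ?n (fun u v => (@?f u v) ^ 2) ?x ?y =>
      apply (Ck_ext n (fun u v => f u v * f u v)); [intros; simpl; ring |]
  | |- Ck ?n (fun u v => Du ?f u v) ?x ?y => apply (Ck_Du n f x y)
  | |- Ck ?n (fun u v => Dv ?f u v) ?x ?y => apply (Ck_Dv n f x y)
  | |- Ck ?n (fun u v => ?f u v) ?x ?y => progress change (Ck n f x y)
  | |- Ck ?n (Du ?f) ?x ?y => apply (Ck_Du n f x y)
  | |- Ck ?n (Dv ?f) ?x ?y => apply (Ck_Dv n f x y)
  | H : Ck ?m ?f ?x ?y |- Ck ?n ?f ?x ?y => apply (Ck_le m n f x y); [lia | exact H]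
  end).

Lemma lagrange_identity (p q : vec3) :
  dot3 (cross3 p q) (cross3 p q) = dot3 p p * dot3 q q - (dot3 p q) ^ 2.
Proof.
  destruct p as [[p1 p2] p3], q as [[q1 q2] q3].
  unfold dot3, cross3, c1, c2, c3; simpl; ring.
Qed.

Lemma dot3_pos (p : vec3) : p <> zero3 -> 0 < dot3 p p.
Proof.
  destruct p as [[p1 p2] p3]; unfold dot3, c1, c2, c3, zero3; simpl; intros H.
  destruct (Req_dec p1 0) as [-> | H1]; [| nra].
  destruct (Req_dec p2 0) as [-> | H2]; [| nra].
  destruct (Req_dec p3 0) as [-> | H3]; [exfalso; apply H; reflexivity | nra].
Qed.

Definition cross_field (X : R -> R -> vec3) (u v : R) : vec3 :=
  cross3 (Du3 X u v) (Dv3 X u v).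

Lemma gdet_cross (X : R -> R -> vec3) (u v : R) :
  gdet X u v = dot3 (cross_field X u v) (cross_field X u v).
Proof. symmetry; apply lagrange_identity. Qed.

Section Regularity.

Context (X : R -> R -> vec3) (HX : immersion_C4 X).
Context (x y : R) (Hxy : closed_disc x y).

Lemma immersion_Ck :
  Ck 4 (fun u v => c1 (X u v)) x y /\ Ck 4 (fun u v => c2 (X u v)) x y /\
  Ck 4 (fun u v => c3 (X u v)) x y.
Proof.
  destruct HX as (H1 & H2 & H3 & _).
  split; [| split]; [apply H1 | apply H2 | apply H3]; exact Hxy.
Qed.

Lemma cross_field_nonzero : 0 < dot3 (cross_field X x y) (cross_field X x y).
Proof. apply dot3_pos; destruct HX as (_ & _ & _ & H); apply H, Hxy. Qed.

Lemma norm_cross_field_pos : 0 < norm3 (cross_field X x y).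
Proof. apply sqrt_lt_R0, cross_field_nonzero. Qed.

Lemma gdet_pos : 0 < gdet X x y.
Proof. rewrite gdet_cross; apply cross_field_nonzero. Qed.

Lemma cross_field_Ck :
  Ck 3 (fun u v => c1 (cross_field X u v)) x y /\
  Ck 3 (fun u v => c2 (cross_field X u v)) x y /\
  Ck 3 (fun u v => c3 (cross_field X u v)) x y.
Proof.
  destruct immersion_Ck as (H1 & H2 & H3).
  unfold cross_field, cross3, Du3, Dv3; cbn [c1 c2 c3 fst snd].
  split; [| split]; unfold c1, c2, c3 in *; simpl; ck.
Qed.

Lemma metric_Ck :
  Ck 3 (gE X) x y /\ Ck 3 (gF X) x y /\ Ck 3 (gG X) x y /\ Ck 3 (gdet X) x y.
Proof.
  destruct immersion_Ck as (H1 & H2 & H3).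
  assert (HE : Ck 3 (gE X) x y)
    by (unfold gE, dot3, Du3, c1, c2, c3 in *; simpl; ck).
  assert (HF : Ck 3 (gF X) x y)
    by (unfold gF, dot3, Du3, Dv3, c1, c2, c3 in *; simpl; ck).
  assert (HG : Ck 3 (gG X) x y)
    by (unfold gG, dot3, Dv3, c1, c2, c3 in *; simpl; ck).
  repeat split; auto.
  unfold gdet; ck.
Qed.

Lemma norm_cross_field_Ck : Ck 3 (fun u v => norm3 (cross_field X u v)) x y.
Proof.
  destruct cross_field_Ck as (H1 & H2 & H3).
  unfold norm3; apply (Ck_sqrt 3); [| apply cross_field_nonzero].
  unfold dot3; ck.
Qed.

Lemma normal_Ck :
  Ck 3 (fun u v => c1 (normal X u v)) x y /\
  Ck 3 (fun u v => c2 (normal X u v)) x y /\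
  Ck 3 (fun u v => c3 (normal X u v)) x y.
Proof.
  destruct cross_field_Ck as (H1 & H2 & H3).
  assert (HN := norm_cross_field_Ck).
  assert (Hi : Ck 3 (fun u v => / norm3 (cross_field X u v)) x y).
  { apply (Ck_inv 3); [exact HN | apply Rgt_not_eq, norm_cross_field_pos]. }
  split; [| split].
  - apply (Ck_ext 3 (fun u v => / norm3 (cross_field X u v) * c1 (cross_field X u v)));
      [reflexivity | ck].
  - apply (Ck_ext 3 (fun u v => / norm3 (cross_field X u v) * c2 (cross_field X u v)));
      [reflexivity | ck].
  - apply (Ck_ext 3 (fun u v => / norm3 (cross_field X u v) * c3 (cross_field X u v)));
      [reflexivity | ck].
Qed.

Lemma curvature_Ck : Ck 2 (mean_curvature X) x y /\ Ck 2 (gauss_curvature X) x y.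
Proof.
  destruct immersion_Ck as (H1 & H2 & H3).
  destruct normal_Ck as (N1 & N2 & N3).
  destruct metric_Ck as (HE & HF & HG & HD).
  assert (Hne := Rgt_not_eq _ _ gdet_pos).
  split.
  - unfold mean_curvature, Du3 at 1 3, Dv3 at 2 4, dot3, Du3, Dv3.
    unfold c1, c2, c3 in *; simpl.
    ck; exact Hne.
  - unfold gauss_curvature, dot3, Du3, Dv3.
    unfold c1, c2, c3 in *; simpl.
    ck; exact Hne.
Qed.

End Regularity.

(** * Polar coordinates on the parameter disc *)

Lemma continuity_pt_comp_2d (f : R -> R -> R) (a b : R -> R) (x : R) :
  continuity_2d_pt f (a x) (b x) -> continuity_pt a x -> continuity_pt b x ->
  continuity_pt (fun t => f (a t) (b t)) x.
Proof.
  intros Hf Ha Hb; apply continuity_pt_locally; intros eps.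
  destruct (Hf eps) as [d Hd].
  apply continuity_pt_locally with (eps := d) in Ha.
  apply continuity_pt_locally with (eps := d) in Hb.
  generalize (filter_and _ _ Ha Hb); apply filter_imp.
  intros t [H1 H2]; auto.
Qed.

Lemma is_derive_comp_2d (f : R -> R -> R) (a b : R -> R) (x da db : R) :
  Ck 1 f (a x) (b x) -> is_derive a x da -> is_derive b x db ->
  is_derive (fun t => f (a t) (b t)) x
    (Du f (a x) (b x) * da + Dv f (a x) (b x) * db).
Proof.
  intros Hf Ha Hb; apply is_derive_Reals.
  apply derivable_pt_lim_comp_2d.
  - apply Ck_differentiable, Hf.
  - apply is_derive_Reals, Ha.
  - apply is_derive_Reals, Hb.
Qed.

Definition polar (g : R -> R -> R) (s t : R) : R := g (s * cos t) (s * sin t).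
Definition polar_s (g : R -> R -> R) (s t : R) : R :=
  polar (Du g) s t * cos t + polar (Dv g) s t * sin t.
Definition polar_t (g : R -> R -> R) (s t : R) : R :=
  s * (polar (Dv g) s t * cos t - polar (Du g) s t * sin t).

Lemma der_id (x : R) : is_derive (fun t => t) x 1.
Proof. apply @is_derive_id. Qed.
Lemma der_cos (x : R) : is_derive cos x (- sin x).
Proof. apply is_derive_Reals, derivable_pt_lim_cos. Qed.
Lemma der_sin (x : R) : is_derive sin x (cos x).
Proof. apply is_derive_Reals, derivable_pt_lim_sin. Qed.

Lemma polar_derive_s (g : R -> R -> R) (s t : R) :
  Ck 1 g (s * cos t) (s * sin t) ->
  is_derive (fun x => polar g x t) s (polar_s g s t).
Proof.
  intros Hg; pose proof (der_id s) as Hi.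
  apply (is_derive_comp_2d g (fun x => x * cos t) (fun x => x * sin t)).
  - exact Hg.
  - der; ring.
  - der; ring.
Qed.

Lemma polar_derive_t (g : R -> R -> R) (s t : R) :
  Ck 1 g (s * cos t) (s * sin t) ->
  is_derive (fun x => polar g s x) t (polar_t g s t).
Proof.
  intros Hg; pose proof (der_cos t); pose proof (der_sin t).
  eapply der_eq.
  - apply (is_derive_comp_2d g (fun x => s * cos x) (fun x => s * sin x) t
             (- s * sin t) (s * cos t)).
    + exact Hg.
    + der; ring.
    + der; ring.
  - unfold polar_t, polar; ring.
Qed.

Lemma closed_disc_polar (s t : R) : -1 <= s <= 1 -> closed_disc (s * cos t) (s * sin t).
Proof.
  intros Hs; unfold closed_disc; generalize (sin2_cos2 t); unfold Rsqr.
  intros E; replace ((s * cos t) ^ 2 + (s * sin t) ^ 2)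
    with (s * s * (sin t * sin t + cos t * cos t)) by ring.
  rewrite E; nra.
Qed.

Lemma open_disc_polar (s t : R) : -1 < s < 1 -> open_disc (s * cos t) (s * sin t).
Proof.
  intros Hs; unfold open_disc; generalize (sin2_cos2 t); unfold Rsqr.
  intros E; replace ((s * cos t) ^ 2 + (s * sin t) ^ 2)
    with (s * s * (sin t * sin t + cos t * cos t)) by ring.
  rewrite E; nra.
Qed.

Lemma angle_exists (x y : R) : x * x + y * y = 1 -> exists t, x = cos t /\ y = sin t.
Proof.
  intros H.
  assert (Hx : -1 <= x <= 1) by nra.
  destruct (Rle_dec 0 y) as [Hy | Hy].
  - exists (acos x); rewrite cos_acos, sin_acos by exact Hx; split; [reflexivity |].
    symmetry; apply sqrt_lem_1; unfold Rsqr; nra.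
  - exists (- acos x); rewrite cos_neg, sin_neg, cos_acos, sin_acos by exact Hx.
    split; [reflexivity |].
    rewrite (sqrt_lem_1 _ (- y)); unfold Rsqr; nra.
Qed.

Lemma angle_exists_scaled (x y rho : R) :
  x * x + y * y = rho * rho -> exists t, x = rho * cos t /\ y = rho * sin t.
Proof.
  intros H; destruct (Req_dec rho 0) as [-> | Hr].
  - exists 0; split; nra.
  - destruct (angle_exists (x / rho) (y / rho)) as (t & Hc & Hs).
    + apply Rmult_eq_reg_r with (rho * rho); [| nra].
      field_simplify; auto; lra.
    + exists t; rewrite <- Hc, <- Hs; split; field; auto.
Qed.

Lemma closed_disc_polar_inv (u v : R) :
  closed_disc u v -> exists s t, 0 <= s <= 1 /\ u = s * cos t /\ v = s * sin t.
Proof.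
  unfold closed_disc; intros H.
  assert (Hp : 0 <= u ^ 2 + v ^ 2) by nra.
  destruct (angle_exists_scaled u v (sqrt (u ^ 2 + v ^ 2))) as (t & Hu & Hv).
  { rewrite sqrt_sqrt by exact Hp; ring. }
  exists (sqrt (u ^ 2 + v ^ 2)), t; split; [| auto].
  split; [apply sqrt_pos |].
  rewrite <- sqrt_1; apply sqrt_le_1_alt, H.
Qed.

Definition px (phi : R -> R -> R * R) (u v : R) : R := fst (phi u v).
Definition py (phi : R -> R -> R * R) (u v : R) : R := snd (phi u v).
Definition jac (phi : R -> R -> R * R) (u v : R) : R :=
  Du (px phi) u v * Dv (py phi) u v - Dv (px phi) u v * Du (py phi) u v.

Definition along (phi : R -> R -> R * R) (g : R -> R -> R) (s t : R) : R :=
  g (polar (px phi) s t) (polar (py phi) s t).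

(** The derivatives of [along phi g] given by the chain rule. *)
Definition along_s (phi : R -> R -> R * R) (g : R -> R -> R) (s t : R) : R :=
  along phi (Du g) s t * polar_s (px phi) s t
  + along phi (Dv g) s t * polar_s (py phi) s t.
Definition along_t (phi : R -> R -> R * R) (g : R -> R -> R) (s t : R) : R :=
  along phi (Du g) s t * polar_t (px phi) s t
  + along phi (Dv g) s t * polar_t (py phi) s t.

Lemma polar_jac phi s t :
  polar_s (px phi) s t * polar_t (py phi) s t
  - polar_t (px phi) s t * polar_s (py phi) s t = s * polar (jac phi) s t.
Proof.
  unfold polar_s, polar_t.
  transitivity (s * polar (jac phi) s t * (Rsqr (sin t) + Rsqr (cos t))).
  - unfold polar, jac, Rsqr; ring.
  - rewrite sin2_cos2; ring.
Qed.

Section Reparametrisation.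

Context (phi : R -> R -> R * R) (Hphi : disc_diffeo_C4 phi).

Lemma phi_Ck u v : closed_disc u v -> Ck 4 (px phi) u v /\ Ck 4 (py phi) u v.
Proof.
  intros H; destruct Hphi as (H1 & H2 & _); split; [apply H1 | apply H2]; exact H.
Qed.

Lemma jac_nonzero u v : closed_disc u v -> jac phi u v <> 0.
Proof.
  intros H; destruct Hphi as (_ & _ & _ & _ & _ & H6); apply (H6 u v H).
Qed.

Lemma jac_Ck u v : closed_disc u v -> Ck 3 (jac phi) u v.
Proof.
  intros H; destruct (phi_Ck u v H) as [H1 H2]; unfold jac; ck.
Qed.

(** The closed disc is connected, so the Jacobian has the same sign everywhere
    as at the centre. *)
Lemma jac_sign s t : 0 <= s <= 1 -> 0 < polar (jac phi) s t * jac phi 0 0.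
Proof.
  intros Hs.
  set (g := fun x => polar (jac phi) (x * s) t).
  assert (Hg : forall x, 0 <= x <= 1 -> continuity_pt g x /\ g x <> 0).
  { intros x Hx; assert (Hxs : -1 <= x * s <= 1) by nra; split.
    - apply (continuity_pt_comp_2d (jac phi) (fun x => x * s * cos t) (fun x => x * s * sin t)).
      + apply (Ck_continuous 3), jac_Ck, closed_disc_polar; lra.
      + pose proof (der_continuous _ _ _ (der_id x)); cont.
      + pose proof (der_continuous _ _ _ (der_id x)); cont.
    - apply jac_nonzero, closed_disc_polar; lra. }
  assert (E0 : g 0 = jac phi 0 0).
  { unfold g, polar; f_equal; ring. }
  assert (E1 : g 1 = polar (jac phi) s t) by (unfold g; f_equal; ring).
  rewrite <- E0, <- E1.
  assert (N0 := proj2 (Hg 0 ltac:(lra))); assert (N1 := proj2 (Hg 1 ltac:(lra))).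
  destruct (Rlt_dec 0 (g 1 * g 0)) as [H | H]; [exact H | exfalso].
  destruct (Rlt_dec (g 0) 0) as [L0 | L0].
  - destruct (IVT_interv g 0 1) as (z & Hz & Ez); try lra; try nra.
    + intros a Ha; apply Hg, Ha.
    + apply (proj2 (Hg z Hz)), Ez.
  - destruct (IVT_interv (fun x => - g x) 0 1) as (z & Hz & Ez); try lra; try nra.
    + intros a Ha; apply cont_opp, Hg, Ha.
    + apply (proj2 (Hg z Hz)); lra.
Qed.

Lemma along_closed s t :
  -1 <= s <= 1 -> closed_disc (polar (px phi) s t) (polar (py phi) s t).
Proof.
  intros Hs; destruct Hphi as (_ & _ & H & _); apply H, closed_disc_polar, Hs.
Qed.

(** An interior maximum of [|phi|^2] would be a critical point of it, which
    the invertibility of [d phi] only allows where [phi = 0]. *)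
Lemma phi_open u v : open_disc u v -> open_disc (px phi u v) (py phi u v).
Proof.
  intros Ho.
  assert (Hc : closed_disc u v) by (unfold closed_disc, open_disc in *; lra).
  destruct Hphi as (_ & _ & Hcl & _ & _ & HJ).
  destruct (Rle_lt_or_eq_dec _ _ (Hcl u v Hc)) as [H | E]; [exact H | exfalso].
  fold (px phi u v) (py phi u v) in E.
  destruct (phi_Ck u v Hc) as [Ka Kb].
  destruct (locally_2d_singleton _ _ _ (Ck_ex_derive_loc _ _ _ _ Ka)) as (_ & Ha1 & Ha2).
  destruct (locally_2d_singleton _ _ _ (Ck_ex_derive_loc _ _ _ _ Kb)) as (_ & Hb1 & Hb2).
  assert (da1 : is_derive (fun t => px phi t v) u (Du (px phi) u v))
    by (apply Derive_correct; exact Ha1).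
  assert (da2 : is_derive (fun t => px phi u t) v (Dv (px phi) u v))
    by (apply Derive_correct; exact Ha2).
  assert (db1 : is_derive (fun t => py phi t v) u (Du (py phi) u v))
    by (apply Derive_correct; exact Hb1).
  assert (db2 : is_derive (fun t => py phi u t) v (Dv (py phi) u v))
    by (apply Derive_correct; exact Hb2).
  assert (HO : locally_2d open_disc u v).
  { assert (Hq : continuity_2d_pt (fun u v => u * u + v * v) u v).
    { apply continuity_2d_pt_plus; apply continuity_2d_pt_mult;
        auto using continuity_2d_pt_id1, continuity_2d_pt_id2. }
    assert (Hp : 0 < 1 - (u * u + v * v)) by (unfold open_disc in Ho; lra).
    destruct (Hq (mkposreal _ Hp)) as [d Hd]; exists d; intros u' v' H1 H2.
    specialize (Hd u' v' H1 H2); simpl in Hd; apply Rabs_def2 in Hd.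
    unfold open_disc; lra. }
  assert (Hle : forall u' v', open_disc u' v' -> px phi u' v' ^ 2 + py phi u' v' ^ 2 <= 1).
  { intros u' v' H; apply Hcl; unfold closed_disc, open_disc in *; lra. }
  assert (Hmax : forall g l x, is_derive g x l ->
            locally x (fun t => g t <= g x) -> l = 0).
  { intros g l x Hd [d HO'].
    apply is_derive_Reals in Hd.
    assert (pr : derivable_pt g x) by (exists l; exact Hd).
    rewrite <- (derive_pt_eq_0 g x l pr Hd).
    apply deriv_maximum with (x - d) (x + d); try (destruct d; simpl; lra).
    intros t H1 H2; apply HO'.
    change (Rabs (t - x) < d); apply Rabs_def1; lra. }
  assert (E1 : 2 * (px phi u v * Du (px phi) u v + py phi u v * Du (py phi) u v) = 0).
  { apply (Hmax (fun t => px phi t v * px phi t v + py phi t v * py phi t v) _ u).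
    - der; ring.
    - generalize (locally_2d_1d_const_y _ _ _ HO); apply filter_imp.
      intros t H; specialize (Hle t v H); nra. }
  assert (E2 : 2 * (px phi u v * Dv (px phi) u v + py phi u v * Dv (py phi) u v) = 0).
  { apply (Hmax (fun t => px phi u t * px phi u t + py phi u t * py phi u t) _ v).
    - der; ring.
    - generalize (locally_2d_1d_const_x _ _ _ HO); apply filter_imp.
      intros t H; specialize (Hle u t H); nra. }
  specialize (HJ u v Hc); fold (px phi) (py phi) in HJ.
  revert HJ E E1 E2; change (fun u v => fst (phi u v)) with (px phi).
  change (fun u v => snd (phi u v)) with (py phi).
  generalize (px phi u v) (py phi u v) (Du (px phi) u v) (Dv (px phi) u v)
    (Du (py phi) u v) (Dv (py phi) u v); clear.
  intros a b au av bu bv HJ E E1 E2.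
  assert (Ha : a * (au * bv - av * bu) = 0).
  { replace (a * (au * bv - av * bu))
      with (bv * (2 * (a * au + b * bu)) / 2 - bu * (2 * (a * av + b * bv)) / 2) by field.
    rewrite E1, E2; field. }
  assert (Hb : b * (au * bv - av * bu) = 0).
  { replace (b * (au * bv - av * bu))
      with (au * (2 * (a * av + b * bv)) / 2 - av * (2 * (a * au + b * bu)) / 2) by field.
    rewrite E1, E2; field. }
  apply Rmult_integral in Ha; apply Rmult_integral in Hb.
  destruct Ha as [-> | Ha]; [| auto]; destruct Hb as [-> | Hb]; [| auto].
  lra.
Qed.

Lemma along_open s t :
  -1 < s < 1 -> open_disc (polar (px phi) s t) (polar (py phi) s t).
Proof. intros Hs; apply phi_open, open_disc_polar, Hs. Qed.

Lemma phi_polar_s s t : -1 <= s <= 1 ->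
  is_derive (fun x => polar (px phi) x t) s (polar_s (px phi) s t) /\
  is_derive (fun x => polar (py phi) x t) s (polar_s (py phi) s t).
Proof.
  intros Hs; destruct (phi_Ck _ _ (closed_disc_polar s t Hs)) as [H1 H2].
  split; apply polar_derive_s; ck.
Qed.

Lemma phi_polar_t s t : -1 <= s <= 1 ->
  is_derive (fun x => polar (px phi) s x) t (polar_t (px phi) s t) /\
  is_derive (fun x => polar (py phi) s x) t (polar_t (py phi) s t).
Proof.
  intros Hs; destruct (phi_Ck _ _ (closed_disc_polar s t Hs)) as [H1 H2].
  split; apply polar_derive_t; ck.
Qed.

Lemma along_derive_s g s t : -1 <= s <= 1 ->
  Ck 1 g (polar (px phi) s t) (polar (py phi) s t) ->
  is_derive (fun x => along phi g x t) s
    (along_s phi g s t).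
Proof.
  intros Hs Hg; destruct (phi_polar_s s t Hs).
  apply (is_derive_comp_2d g (fun x => polar (px phi) x t) (fun x => polar (py phi) x t));
    assumption.
Qed.

Lemma along_derive_t g s t : -1 <= s <= 1 ->
  Ck 1 g (polar (px phi) s t) (polar (py phi) s t) ->
  is_derive (fun x => along phi g s x) t
    (along_t phi g s t).
Proof.
  intros Hs Hg; destruct (phi_polar_t s t Hs).
  apply (is_derive_comp_2d g (fun x => polar (px phi) s x) (fun x => polar (py phi) s x));
    assumption.
Qed.

Lemma along_continuous g s t : -1 <= s <= 1 ->
  continuity_2d_pt g (polar (px phi) s t) (polar (py phi) s t) ->
  continuity_pt (fun x => along phi g x t) s.
Proof.
  intros Hs Hg; destruct (phi_polar_s s t Hs) as [H1 H2].
  apply (continuity_pt_comp_2d g (fun x => polar (px phi) x t) (fun x => polar (py phi) x t)).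
  - exact Hg.
  - apply (der_continuous _ _ _ H1).
  - apply (der_continuous _ _ _ H2).
Qed.

End Reparametrisation.

(** * The geometry of a surface of revolution in polar coordinates *)

Definition comp1 (X : R -> R -> vec3) (u v : R) : R := c1 (X u v).
Definition comp2 (X : R -> R -> vec3) (u v : R) : R := c2 (X u v).
Definition comp3 (X : R -> R -> vec3) (u v : R) : R := c3 (X u v).

Lemma cross_along X phi s t :
  s * polar (jac phi) s t * along phi (comp1 (cross_field X)) s t
    = along_s phi (comp2 X) s t * along_t phi (comp3 X) s t
      - along_s phi (comp3 X) s t * along_t phi (comp2 X) s t /\
  s * polar (jac phi) s t * along phi (comp2 (cross_field X)) s t
    = along_s phi (comp3 X) s t * along_t phi (comp1 X) s t
      - along_s phi (comp1 X) s t * along_t phi (comp3 X) s t /\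
  s * polar (jac phi) s t * along phi (comp3 (cross_field X)) s t
    = along_s phi (comp1 X) s t * along_t phi (comp2 X) s t
      - along_s phi (comp2 X) s t * along_t phi (comp1 X) s t.
Proof.
  rewrite <- polar_jac.
  change (along phi (comp1 (cross_field X)) s t) with
    (along phi (Du (comp2 X)) s t * along phi (Dv (comp3 X)) s t
     - along phi (Du (comp3 X)) s t * along phi (Dv (comp2 X)) s t).
  change (along phi (comp2 (cross_field X)) s t) with
    (along phi (Du (comp3 X)) s t * along phi (Dv (comp1 X)) s t
     - along phi (Du (comp1 X)) s t * along phi (Dv (comp3 X)) s t).
  change (along phi (comp3 (cross_field X)) s t) with
    (along phi (Du (comp1 X)) s t * along phi (Dv (comp2 X)) s t
     - along phi (Du (comp2 X)) s t * along phi (Dv (comp1 X)) s t).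
  unfold along_s, along_t; repeat split; ring.
Qed.

(** Schwarz's theorem for [b], transported to polar coordinates. *)
Lemma polar_symmetric (b : R -> R -> R) (s : R) :
  -1 <= s <= 1 -> Ck 2 b (s * cos 0) (s * sin 0) ->
  exists l, is_derive (fun x => polar_t b x 0) s l /\
            is_derive (fun x => polar_s b s x) 0 l.
Proof.
  intros Hs Hb; exists (polar (Dv b) s 0 + s * polar (Du (Dv b)) s 0).
  pose proof (polar_derive_s (Du b) s 0 (Ck_Du _ _ _ _ Hb)) as H1.
  pose proof (polar_derive_s (Dv b) s 0 (Ck_Dv _ _ _ _ Hb)) as H2.
  pose proof (polar_derive_t (Du b) s 0 (Ck_Du _ _ _ _ Hb)) as H3.
  pose proof (polar_derive_t (Dv b) s 0 (Ck_Dv _ _ _ _ Hb)) as H4.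
  pose proof (der_id s); pose proof (der_cos 0); pose proof (der_sin 0).
  assert (E : polar (Du (Dv b)) s 0 = polar (Dv (Du b)) s 0)
    by (apply Ck_symmetric, Hb).
  split.
  - unfold polar_t; der.
    unfold polar_s; rewrite cos_0, sin_0; ring.
  - unfold polar_s; der.
    unfold polar_t; rewrite cos_0, sin_0, E; ring.
Qed.

(** Traces and determinants of the shape operator do not depend on the
    coordinates; [as_], [bs], [at_], [bt] are the entries of the matrix of the
    change of coordinates. *)
Lemma shape_operator_invariance
  (as_ bs at_ bt E F G B11 B12 B21 B22 : R) :
  let J := as_ * bt - at_ * bs in
  let E' := as_ * as_ * E + 2 * (as_ * bs) * F + bs * bs * G in
  let F' := as_ * at_ * E + (as_ * bt + bs * at_) * F + bs * bt * G in
  let G' := at_ * at_ * E + 2 * (at_ * bt) * F + bt * bt * G in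
  let B11' := as_ * as_ * B11 + as_ * bs * (B12 + B21) + bs * bs * B22 in
  let B12' := as_ * at_ * B11 + as_ * bt * B12 + bs * at_ * B21 + bs * bt * B22 in
  let B21' := at_ * as_ * B11 + at_ * bs * B12 + bt * as_ * B21 + bt * bs * B22 in
  let B22' := at_ * at_ * B11 + at_ * bt * (B12 + B21) + bt * bt * B22 in
  J <> 0 -> E * G - F ^ 2 <> 0 ->
  (B11 * G - (B12 + B21) * F + B22 * E) / (E * G - F ^ 2)
  = (B11' * G' - (B12' + B21') * F' + B22' * E') / (E' * G' - F' ^ 2) /\
  (B11 * B22 - B12 * B21) / (E * G - F ^ 2)
  = (B11' * B22' - B12' * B21') / (E' * G' - F' ^ 2).
Proof.
  intros J E' F' G' B11' B12' B21' B22' HJ HD.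
  replace (E' * G' - F' ^ 2) with (J * J * (E * G - F ^ 2))
    by (unfold E', F', G', J; ring).
  replace (B11' * G' - (B12' + B21') * F' + B22' * E')
    with (J * J * (B11 * G - (B12 + B21) * F + B22 * E))
    by (unfold E', F', G', B11', B12', B21', B22', J; ring).
  replace (B11' * B22' - B12' * B21')
    with (J * J * (B11 * B22 - B12 * B21))
    by (unfold B11', B12', B21', B22', J; ring).
  split; field; auto.
Qed.

Lemma unit_normal X : immersion_C4 X -> forall u v, closed_disc u v ->
  norm3 (cross_field X u v) * comp1 (normal X) u v = comp1 (cross_field X) u v /\
  norm3 (cross_field X u v) * comp2 (normal X) u v = comp2 (cross_field X) u v /\
  norm3 (cross_field X u v) * comp3 (normal X) u v = comp3 (cross_field X) u v /\
  comp1 (normal X) u v ^ 2 + comp2 (normal X) u v ^ 2 + comp3 (normal X) u v ^ 2 = 1.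
Proof.
  intros HX u v H.
  assert (Hp := norm_cross_field_pos X HX u v H).
  assert (Hq := cross_field_nonzero X HX u v H).
  assert (Hsq : norm3 (cross_field X u v) * norm3 (cross_field X u v)
                = dot3 (cross_field X u v) (cross_field X u v)).
  { apply sqrt_sqrt; lra. }
  unfold dot3 in Hsq.
  change (normal X) with
    (fun u v => scal3 (/ norm3 (cross_field X u v)) (cross_field X u v)).
  unfold comp1, comp2, comp3.
  change (c1 (scal3 (/ norm3 (cross_field X u v)) (cross_field X u v)))
    with (/ norm3 (cross_field X u v) * c1 (cross_field X u v)).
  change (c2 (scal3 (/ norm3 (cross_field X u v)) (cross_field X u v)))
    with (/ norm3 (cross_field X u v) * c2 (cross_field X u v)).
  change (c3 (scal3 (/ norm3 (cross_field X u v)) (cross_field X u v)))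
    with (/ norm3 (cross_field X u v) * c3 (cross_field X u v)).
  repeat split; try (field; lra).
  set (N := norm3 (cross_field X u v)) in *.
  transitivity (/ (N * N) * (c1 (cross_field X u v) * c1 (cross_field X u v)
    + c2 (cross_field X u v) * c2 (cross_field X u v)
    + c3 (cross_field X u v) * c3 (cross_field X u v))).
  - field; lra.
  - rewrite <- Hsq; field; lra.
Qed.

Section Revolution.

Context (X : R -> R -> vec3) (phi : R -> R -> R * R) (r h : R -> R).
Context (HX : immersion_C4 X) (Hphi : disc_diffeo_C4 phi).
Context (Hrot : forall s theta, 0 <= s <= 1 ->
   let p := phi (s * cos theta) (s * sin theta) in
   X (fst p) (snd p) = (r s * cos theta, r s * sin theta, h s)).

(** The profile curve is extended to negative [s] as the opposite meridian,
    so that [s = 0] becomes an interior point, where [rho] is odd and [zeta]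
    even. *)
Let rho s := along phi (comp1 X) s 0.
Let zeta s := along phi (comp3 X) s 0.
Let C s := along phi (comp3 (normal X)) s 0.
Let S s := - along phi (comp1 (normal X)) s 0.
Let F s := along phi (mean_curvature X) s 0.
Let K s := along phi (gauss_curvature X) s 0.
Let drho s := along_s phi (comp1 X) s 0.
Let dzeta s := along_s phi (comp3 X) s 0.
Let dF s := along_s phi (mean_curvature X) s 0.
(** The signed speed of the profile with respect to the frame (C, S). *)
Let v s := drho s * C s + dzeta s * S s.

Lemma along_position s t : -1 <= s <= 1 ->
  along phi (comp1 X) s t = rho s * cos t /\
  along phi (comp2 X) s t = rho s * sin t /\
  along phi (comp3 X) s t = zeta s.
Proof.
  assert (Hpos : forall s t, 0 <= s <= 1 ->
    along phi (comp1 X) s t = r s * cos t /\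
    along phi (comp2 X) s t = r s * sin t /\
    along phi (comp3 X) s t = h s).
  { intros s' t' Hs.
    unfold along, polar, comp1, comp2, comp3, px, py.
    rewrite (Hrot s' t' Hs); repeat split. }
  assert (Hneg : forall g s t, along phi g s t = along phi g (- s) (t + PI)).
  { intros g s' t'; unfold along, polar; rewrite neg_cos, neg_sin.
    replace (- s' * - cos t') with (s' * cos t') by ring.
    replace (- s' * - sin t') with (s' * sin t') by ring; reflexivity. }
  intros Hs; unfold rho, zeta.
  destruct (Rle_dec 0 s) as [H | H].
  - destruct (Hpos s t) as (-> & -> & ->); [lra |].
    destruct (Hpos s 0) as (-> & _ & ->); [lra |].
    rewrite cos_0; repeat split; ring.
  - rewrite !(Hneg _ s).
    destruct (Hpos (- s) (t + PI)) as (-> & -> & ->); [lra |].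
    destruct (Hpos (- s) (0 + PI)) as (-> & _ & ->); [lra |].
    rewrite !neg_cos, neg_sin, cos_0; repeat split; ring.
Qed.

Lemma along_Ck s t : -1 <= s <= 1 ->
  let P n g := Ck n g (polar (px phi) s t) (polar (py phi) s t) in
  P 4%nat (comp1 X) /\ P 4%nat (comp2 X) /\ P 4%nat (comp3 X) /\
  P 3%nat (comp1 (normal X)) /\ P 3%nat (comp2 (normal X)) /\ P 3%nat (comp3 (normal X)) /\
  P 2%nat (mean_curvature X) /\ P 2%nat (gauss_curvature X).
Proof.
  intros Hs P; assert (Hc := along_closed phi Hphi s t Hs).
  destruct (immersion_Ck X HX _ _ Hc) as (H1 & H2 & H3).
  destruct (normal_Ck X HX _ _ Hc) as (N1 & N2 & N3).
  destruct (curvature_Ck X HX _ _ Hc) as (CH & CK).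
  repeat split; assumption.
Qed.

Lemma along_s_continuous g s : -1 <= s <= 1 ->
  Ck 1 g (polar (px phi) s 0) (polar (py phi) s 0) ->
  continuity_pt (fun x => along_s phi g x 0) s.
Proof.
  intros Hs Hg; unfold along_s.
  destruct (phi_Ck phi Hphi _ _ (closed_disc_polar s 0 Hs)) as [Ka Kb].
  assert (Hp : forall a, Ck 4 a (s * cos 0) (s * sin 0) ->
                    continuity_pt (fun x => polar_s a x 0) s).
  { intros a Ka'; unfold polar_s.
    assert (K1 : Ck 1 (Du a) (s * cos 0) (s * sin 0)) by ck.
    assert (K2 : Ck 1 (Dv a) (s * cos 0) (s * sin 0)) by ck.
    pose proof (der_continuous _ _ _ (polar_derive_s _ s 0 K1)).
    pose proof (der_continuous _ _ _ (polar_derive_s _ s 0 K2)).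
    cont. }
  pose proof (Hp _ Ka); pose proof (Hp _ Kb).
  assert (continuity_pt (fun x => along phi (Du g) x 0) s).
  { apply (along_continuous phi Hphi); [exact Hs |].
    apply (Ck_continuous 0), Ck_Du, Hg. }
  assert (continuity_pt (fun x => along phi (Dv g) x 0) s).
  { apply (along_continuous phi Hphi); [exact Hs |].
    apply (Ck_continuous 0), Ck_Dv, Hg. }
  cont.
Qed.

Lemma locally_open_interval (a b s : R) (P : R -> Prop) :
  a < s < b -> (forall x, a < x < b -> P x) -> locally s P.
Proof.
  intros Hs HP.
  assert (Hd : 0 < Rmin (s - a) (b - s)) by (apply Rmin_glb_lt; lra).
  exists (mkposreal _ Hd); intros x Hx.
  change (Rabs (x - s) < Rmin (s - a) (b - s)) in Hx.
  apply Rabs_def2 in Hx.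
  generalize (Rmin_l (s - a) (b - s)) (Rmin_r (s - a) (b - s)); intros.
  apply HP; lra.
Qed.

Lemma derive_eq_on (f g : R -> R) (a b s l m : R) :
  a < s < b -> (forall x, a < x < b -> f x = g x) ->
  is_derive f s l -> is_derive g s m -> l = m.
Proof.
  intros Hs Hfg Hf Hg.
  rewrite <- (is_derive_unique _ _ _ Hg).
  symmetry; apply is_derive_unique.
  apply is_derive_ext_loc with f; [| exact Hf].
  apply (locally_open_interval a b); assumption.
Qed.

Lemma rho_derive s : -1 <= s <= 1 -> is_derive rho s (drho s).
Proof.
  intros Hs; destruct (along_Ck s 0 Hs) as (K1 & _).
  apply (along_derive_s phi Hphi); [exact Hs | ck].
Qed.

Lemma zeta_derive s : -1 <= s <= 1 -> is_derive zeta s (dzeta s).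
Proof.
  intros Hs; destruct (along_Ck s 0 Hs) as (_ & _ & K1 & _).
  apply (along_derive_s phi Hphi); [exact Hs | ck].
Qed.

Lemma along_s_position s t : -1 < s < 1 ->
  along_s phi (comp1 X) s t = drho s * cos t /\
  along_s phi (comp2 X) s t = drho s * sin t /\
  along_s phi (comp3 X) s t = dzeta s.
Proof.
  intros Hs; assert (Hs' : -1 <= s <= 1) by lra.
  destruct (along_Ck s t Hs') as (K1 & K2 & K3 & _).
  pose proof (rho_derive s Hs'); pose proof (zeta_derive s Hs').
  split; [| split].
  - apply (derive_eq_on (fun x => along phi (comp1 X) x t) (fun x => rho x * cos t) (-1) 1 s);
      [exact Hs | | apply (along_derive_s phi Hphi); [lra | ck] | der; ring].
    intros x Hx; apply along_position; lra.
  - apply (derive_eq_on (fun x => along phi (comp2 X) x t) (fun x => rho x * sin t) (-1) 1 s);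
      [exact Hs | | apply (along_derive_s phi Hphi); [lra | ck] | der; ring].
    intros x Hx; apply along_position; lra.
  - apply (derive_eq_on (fun x => along phi (comp3 X) x t) zeta (-1) 1 s);
      [exact Hs | | apply (along_derive_s phi Hphi); [lra | ck] | assumption].
    intros x Hx; apply along_position; lra.
Qed.

Lemma along_t_position s t : -1 <= s <= 1 ->
  along_t phi (comp1 X) s t = - (rho s * sin t) /\
  along_t phi (comp2 X) s t = rho s * cos t /\
  along_t phi (comp3 X) s t = 0.
Proof.
  intros Hs.
  destruct (along_Ck s t Hs) as (K1 & K2 & K3 & _).
  pose proof (der_cos t); pose proof (der_sin t).
  split; [| split].
  - apply (derive_eq_on (fun x => along phi (comp1 X) s x) (fun x => rho s * cos x) (t - 1) (t + 1) t);
      [lra | | apply (along_derive_t phi Hphi); [lra | ck] | der; ring].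
    intros x Hx; apply along_position; lra.
  - apply (derive_eq_on (fun x => along phi (comp2 X) s x) (fun x => rho s * sin x) (t - 1) (t + 1) t);
      [lra | | apply (along_derive_t phi Hphi); [lra | ck] | der; ring].
    intros x Hx; apply along_position; lra.
  - apply (derive_eq_on (fun x => along phi (comp3 X) s x) (fun x => zeta s) (t - 1) (t + 1) t);
      [lra | | apply (along_derive_t phi Hphi); [lra | ck] | apply der_const].
    intros x Hx; apply along_position; lra.
Qed.

Lemma rho_0 : rho 0 = 0.
Proof.
  destruct (along_position 0 PI) as (H & _); [lra |].
  assert (E : along phi (comp1 X) 0 PI = rho 0).
  { unfold rho, along, polar; rewrite !Rmult_0_l; reflexivity. }
  rewrite E, cos_PI in H; lra.
Qed.

Lemma cross_field_along_nonzero s t : -1 <= s <= 1 ->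
  along phi (comp1 (cross_field X)) s t = 0 -> along phi (comp2 (cross_field X)) s t = 0 ->
  along phi (comp3 (cross_field X)) s t = 0 -> False.
Proof.
  intros Hs H1 H2 H3.
  assert (H := cross_field_nonzero X HX _ _ (along_closed phi Hphi s t Hs)).
  unfold dot3 in H; unfold along, comp1, comp2, comp3 in H1, H2, H3.
  rewrite H1, H2, H3 in H; lra.
Qed.

(** At a return to the axis the parallel would shrink to a point, so that
    Z_t = 0. *)
Lemma rho_nonzero s : 0 < s <= 1 -> rho s <> 0.
Proof.
  intros Hs E.
  destruct (along_t_position s 0) as (T1 & T2 & T3); [lra |].
  destruct (cross_along X phi s 0) as (H1 & H2 & H3).
  rewrite E in *; rewrite T1, T2, T3 in *.
  assert (HJ : s * polar (jac phi) s 0 <> 0).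
  { apply Rmult_integral_contrapositive_currified; [lra |].
    apply (jac_nonzero phi Hphi), closed_disc_polar; lra. }
  assert (Hz : forall a, s * polar (jac phi) s 0 * a = 0 -> a = 0).
  { intros a Ha; apply Rmult_integral in Ha; tauto. }
  apply (cross_field_along_nonzero s 0); [lra | | |]; apply Hz.
  - rewrite H1; ring.
  - rewrite H2; ring.
  - rewrite H3; ring.
Qed.

(** The height is an even function of s. *)
Lemma dzeta_0 : dzeta 0 = 0.
Proof.
  assert (Hd := zeta_derive 0 ltac:(lra)).
  assert (E : dzeta 0 = - dzeta 0); [| lra].
  apply (derive_eq_on zeta (fun x => zeta (- x)) (-1) 1 0); [lra | | exact Hd |].
  - intros x Hx.
    destruct (along_position (- x) PI) as (_ & _ & <-); [lra |].
    unfold zeta, along, polar; rewrite cos_0, sin_0, cos_PI, sin_PI.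
    replace (- x * -1) with (x * 1) by ring.
    replace (- x * 0) with (x * 0) by ring; reflexivity.
  - rewrite <- Ropp_0 in Hd at 1.
    eapply der_eq.
    + apply (is_derive_comp zeta (fun x => - x) 0 (dzeta 0) (-1)); [exact Hd |].
      pose proof (der_id 0); der; ring.
    + unfold scal; simpl; unfold mult; simpl; ring.
Qed.

(** Since the height has zero derivative at the centre, the vanishing of that
    of the radius would make the differential of the immersion degenerate. *)
Lemma drho_0 : drho 0 <> 0.
Proof.
  intros E.
  destruct (along_s_position 0 0) as (A1 & A2 & A3); [lra |].
  rewrite E, dzeta_0 in *.
  unfold along_s, polar_s in *.
  rewrite cos_0, sin_0, Rmult_0_l in *.
  assert (HJ : jac phi 0 0 <> 0)
    by (apply (jac_nonzero phi Hphi); unfold closed_disc; lra).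
  assert (Hp : forall g, polar g 0 0 = g 0 0)
    by (intros; unfold polar; rewrite !Rmult_0_l; reflexivity).
  rewrite !Hp in *; unfold jac in HJ.
  revert HJ A1 A2 A3.
  generalize (Du (px phi) 0 0) (Dv (px phi) 0 0) (Du (py phi) 0 0) (Dv (py phi) 0 0).
  intros a a' b b' HJ A1 A2 A3.
  assert (Hz : forall p1 q1 p2 q2,
    p1 * (a * 1 + a' * 0) + q1 * (b * 1 + b' * 0) = 0 ->
    p2 * (a * 1 + a' * 0) + q2 * (b * 1 + b' * 0) = 0 -> p1 * q2 - p2 * q1 = 0).
  { intros p1 q1 p2 q2 H1 H2.
    apply Rmult_eq_reg_l with (2 := HJ).
    transitivity
      (b' * (q2 * (p1 * (a * 1 + a' * 0) + q1 * (b * 1 + b' * 0))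
             - q1 * (p2 * (a * 1 + a' * 0) + q2 * (b * 1 + b' * 0)))
       + a' * (p2 * (p1 * (a * 1 + a' * 0) + q1 * (b * 1 + b' * 0))
               - p1 * (p2 * (a * 1 + a' * 0) + q2 * (b * 1 + b' * 0)))); [ring |].
    rewrite H1, H2; ring. }
  apply (cross_field_along_nonzero 0 0); [lra | | |]; apply Hz; assumption.
Qed.

(** * The normal, the curvatures and the Euler-Lagrange equation *)

(** The signed area density of the polar parametrisation Z of the surface:
    Z_s x Z_t is [m] times the unit normal. *)
Let m s t := s * polar (jac phi) s t * along phi (fun u v => norm3 (cross_field X u v)) s t.

Lemma along_normal_scaled s t : -1 < s < 1 ->
  m s t * along phi (comp1 (normal X)) s t = - (dzeta s * rho s * cos t) /\
  m s t * along phi (comp2 (normal X)) s t = - (dzeta s * rho s * sin t) /\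
  m s t * along phi (comp3 (normal X)) s t = drho s * rho s.
Proof.
  intros Hs.
  destruct (unit_normal X HX _ _ (along_closed phi Hphi s t ltac:(lra))) as (N1 & N2 & N3 & _).
  destruct (along_s_position s t Hs) as (A1 & A2 & A3).
  destruct (along_t_position s t) as (B1 & B2 & B3); [lra |].
  destruct (cross_along X phi s t) as (E1 & E2 & E3).
  assert (E := sin2_cos2 t); unfold Rsqr in E.
  rewrite A1, A2, A3, B1, B2, B3 in *.
  unfold m, along in *; rewrite !Rmult_assoc, N1, N2, N3, <- !Rmult_assoc, E1, E2, E3.
  repeat split; try ring.
  transitivity (drho s * rho s * (sin t * sin t + cos t * cos t)); [ring |].
  rewrite E; ring.
Qed.

Lemma along_unit_normal s t : -1 <= s <= 1 ->
  along phi (comp1 (normal X)) s t ^ 2 + along phi (comp2 (normal X)) s t ^ 2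
  + along phi (comp3 (normal X)) s t ^ 2 = 1.
Proof.
  intros Hs; apply (unit_normal X HX _ _ (along_closed phi Hphi s t Hs)).
Qed.

Lemma m_sign s t : 0 < s <= 1 -> 0 < m s t * m s 0.
Proof.
  intros Hs; unfold m.
  assert (J1 := jac_sign phi Hphi s t ltac:(lra)).
  assert (J2 := jac_sign phi Hphi s 0 ltac:(lra)).
  assert (D1 := norm_cross_field_pos X HX _ _ (along_closed phi Hphi s t ltac:(lra))).
  assert (D2 := norm_cross_field_pos X HX _ _ (along_closed phi Hphi s 0 ltac:(lra))).
  fold (along phi (fun u v => norm3 (cross_field X u v)) s t) in D1.
  fold (along phi (fun u v => norm3 (cross_field X u v)) s 0) in D2.
  revert J1 J2 D1 D2; generalize (polar (jac phi) s t) (polar (jac phi) s 0)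
    (jac phi 0 0) (along phi (fun u v => norm3 (cross_field X u v)) s t)
    (along phi (fun u v => norm3 (cross_field X u v)) s 0).
  intros a b c d e J1 J2 D1 D2.
  assert (0 < a * b).
  { assert (0 < (a * b) * (c * c)) by (replace (a * b * (c * c)) with (a * c * (b * c)) by ring;
          apply Rmult_lt_0_compat; assumption).
    assert (0 <= c * c) by nra.
    nra. }
  replace (s * a * d * (s * b * e)) with (s * s * (a * b) * (d * e)) by ring.
  assert (0 < s * s) by nra; assert (0 < d * e) by (apply Rmult_lt_0_compat; lra).
  apply Rmult_lt_0_compat; [apply Rmult_lt_0_compat |]; assumption.
Qed.

(** The modulus |Z_s x Z_t| of [m] does not depend on t because of the
    rotational symmetry, and [m] does not change sign. *)
Lemma m_rotation s t : 0 < s < 1 -> m s t = m s 0.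
Proof.
  intros Hs.
  assert (Hsq : forall t, m s t * m s t = rho s * rho s * (drho s * drho s + dzeta s * dzeta s)).
  { intros t'.
    destruct (along_normal_scaled s t') as (E1 & E2 & E3); [lra |].
    assert (U := along_unit_normal s t' ltac:(lra)).
    assert (E := sin2_cos2 t'); unfold Rsqr in E.
    transitivity ((m s t' * along phi (comp1 (normal X)) s t') ^ 2
      + (m s t' * along phi (comp2 (normal X)) s t') ^ 2
      + (m s t' * along phi (comp3 (normal X)) s t') ^ 2).
    - transitivity (m s t' * m s t' * (along phi (comp1 (normal X)) s t' ^ 2
        + along phi (comp2 (normal X)) s t' ^ 2 + along phi (comp3 (normal X)) s t' ^ 2));
        [rewrite U; ring | ring].
    - rewrite E1, E2, E3.
      transitivity (rho s * rho s * (drho s * drho s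
        + dzeta s * dzeta s * (sin t' * sin t' + cos t' * cos t'))); [ring |].
      rewrite E; ring. }
  assert (H1 := Hsq t); rewrite <- (Hsq 0) in H1.
  assert (H2 := m_sign s t ltac:(lra)).
  assert (H3 : (m s t - m s 0) * (m s t + m s 0) = 0) by lra.
  apply Rmult_integral in H3; destruct H3 as [H3 | H3]; [lra |].
  replace (m s t) with (- m s 0) in H2 by lra; nra.
Qed.

Lemma m_nonzero s t : 0 < s <= 1 -> m s t <> 0.
Proof. intros Hs E; generalize (m_sign s t Hs); rewrite E; lra. Qed.

Lemma along_normal s t : 0 < s < 1 ->
  along phi (comp1 (normal X)) s t = - (S s * cos t) /\
  along phi (comp2 (normal X)) s t = - (S s * sin t) /\
  along phi (comp3 (normal X)) s t = C s.
Proof.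
  intros Hs.
  destruct (along_normal_scaled s t) as (E1 & E2 & E3); [lra |].
  destruct (along_normal_scaled s 0) as (F1 & F2 & F3); [lra |].
  rewrite m_rotation in E1, E2, E3 by exact Hs.
  rewrite cos_0 in F1.
  assert (Hm := m_nonzero s 0 ltac:(lra)).
  unfold S, C; repeat split; apply Rmult_eq_reg_l with (2 := Hm).
  - rewrite E1; transitivity (m s 0 * along phi (comp1 (normal X)) s 0 * cos t);
      [rewrite F1 |]; ring.
  - rewrite E2; transitivity (m s 0 * along phi (comp1 (normal X)) s 0 * sin t);
      [rewrite F1 |]; ring.
  - rewrite E3, F3; reflexivity.
Qed.

Lemma profile_unit s : 0 < s < 1 -> C s * C s + S s * S s = 1.
Proof.
  intros Hs.
  destruct (along_normal s 0 Hs) as (_ & E2 & _).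
  assert (U := along_unit_normal s 0 ltac:(lra)).
  rewrite E2, sin_0 in U; unfold C, S in *; lra.
Qed.

(** Expand Z_s x Z_t = [m] (- S, 0, C) on the meridian t = 0. *)
Lemma m_velocity s : 0 < s < 1 -> m s 0 = rho s * v s.
Proof.
  intros Hs.
  destruct (along_normal_scaled s 0) as (F1 & F2 & F3); [lra |].
  assert (U := profile_unit s Hs).
  rewrite cos_0 in F1.
  fold (C s) in F3.
  transitivity (m s 0 * (C s * C s + S s * S s)); [rewrite U; ring |].
  transitivity (m s 0 * C s * C s
    - (m s 0 * along phi (comp1 (normal X)) s 0) * S s); [unfold S; ring |].
  rewrite F1, F3; unfold v; ring.
Qed.

Lemma profile_tangent s : 0 < s < 1 -> drho s = v s * C s /\ dzeta s = v s * S s.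
Proof.
  intros Hs.
  destruct (along_normal_scaled s 0) as (F1 & F2 & F3); [lra |].
  rewrite cos_0 in F1.
  rewrite m_velocity in F1, F3 by exact Hs.
  fold (C s) in F3.
  assert (Hr := rho_nonzero s ltac:(lra)).
  split; apply Rmult_eq_reg_l with (2 := Hr).
  - lra.
  - unfold S; lra.
Qed.

Lemma v_nonzero s : 0 < s < 1 -> v s <> 0.
Proof.
  intros Hs E; apply (m_nonzero s 0); [lra |].
  rewrite m_velocity, E by exact Hs; ring.
Qed.

Let dC s := along_s phi (comp3 (normal X)) s 0.
Let dS s := - along_s phi (comp1 (normal X)) s 0.

Lemma C_derive s : -1 <= s <= 1 -> is_derive C s (dC s).
Proof.
  intros Hs; destruct (along_Ck s 0 Hs) as (_ & _ & _ & _ & _ & K1 & _).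
  apply (along_derive_s phi Hphi); [exact Hs | ck].
Qed.

Lemma S_derive s : -1 <= s <= 1 -> is_derive S s (dS s).
Proof.
  intros Hs; destruct (along_Ck s 0 Hs) as (_ & _ & _ & K1 & _).
  apply der_opp, (along_derive_s phi Hphi); [exact Hs | ck].
Qed.

Lemma along_s_normal s t : 0 < s < 1 ->
  along_s phi (comp1 (normal X)) s t = - (dS s * cos t) /\
  along_s phi (comp2 (normal X)) s t = - (dS s * sin t) /\
  along_s phi (comp3 (normal X)) s t = dC s.
Proof.
  intros Hs; assert (Hs' : -1 <= s <= 1) by lra.
  destruct (along_Ck s t Hs') as (_ & _ & _ & K1 & K2 & K3 & _).
  pose proof (C_derive s Hs'); pose proof (S_derive s Hs').
  split; [| split].
  - apply (derive_eq_on (fun x => along phi (comp1 (normal X)) x t) (fun x => - (S x * cos t)) 0 1 s);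
      [exact Hs | | apply (along_derive_s phi Hphi); [lra | ck] | der; ring].
    intros x Hx; apply along_normal; lra.
  - apply (derive_eq_on (fun x => along phi (comp2 (normal X)) x t) (fun x => - (S x * sin t)) 0 1 s);
      [exact Hs | | apply (along_derive_s phi Hphi); [lra | ck] | der; ring].
    intros x Hx; apply along_normal; lra.
  - apply (derive_eq_on (fun x => along phi (comp3 (normal X)) x t) C 0 1 s);
      [exact Hs | | apply (along_derive_s phi Hphi); [lra | ck] | assumption].
    intros x Hx; apply along_normal; lra.
Qed.

Lemma along_t_normal s t : 0 < s < 1 ->
  along_t phi (comp1 (normal X)) s t = S s * sin t /\
  along_t phi (comp2 (normal X)) s t = - (S s * cos t) /\
  along_t phi (comp3 (normal X)) s t = 0.
Proof.
  intros Hs; assert (Hs' : -1 <= s <= 1) by lra.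
  destruct (along_Ck s t Hs') as (_ & _ & _ & K1 & K2 & K3 & _).
  pose proof (der_cos t); pose proof (der_sin t).
  split; [| split].
  - apply (derive_eq_on (fun x => along phi (comp1 (normal X)) s x) (fun x => - (S s * cos x)) (t - 1) (t + 1) t);
      [lra | | apply (along_derive_t phi Hphi); [lra | ck] | der; ring].
    intros x Hx; apply along_normal; lra.
  - apply (derive_eq_on (fun x => along phi (comp2 (normal X)) s x) (fun x => - (S s * sin x)) (t - 1) (t + 1) t);
      [lra | | apply (along_derive_t phi Hphi); [lra | ck] | der; ring].
    intros x Hx; apply along_normal; lra.
  - apply (derive_eq_on (fun x => along phi (comp3 (normal X)) s x) (fun x => C s) (t - 1) (t + 1) t);
      [lra | | apply (along_derive_t phi Hphi); [lra | ck] | apply der_const].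
    intros x Hx; apply along_normal; lra.
Qed.

(** In polar coordinates the metric is v^2 ds^2 + rho^2 dt^2. *)
Lemma metric_polar s t : 0 < s < 1 ->
  let E := along phi (gE X) s t in
  let F := along phi (gF X) s t in
  let G := along phi (gG X) s t in
  let a1 := polar_s (px phi) s t in let b1 := polar_s (py phi) s t in
  let a2 := polar_t (px phi) s t in let b2 := polar_t (py phi) s t in
  a1 * a1 * E + 2 * (a1 * b1) * F + b1 * b1 * G = v s * v s /\
  a1 * a2 * E + (a1 * b2 + b1 * a2) * F + b1 * b2 * G = 0 /\
  a2 * a2 * E + 2 * (a2 * b2) * F + b2 * b2 * G = rho s * rho s.
Proof.
  intros Hs E F' G a1 b1 a2 b2.
  destruct (along_s_position s t) as (A1 & A2 & A3); [lra |].
  destruct (along_t_position s t) as (B1 & B2 & B3); [lra |].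
  destruct (profile_tangent s Hs) as (T1 & T2).
  assert (U := profile_unit s Hs).
  assert (Q := sin2_cos2 t); unfold Rsqr in Q.
  split; [| split].
  - transitivity (along_s phi (comp1 X) s t * along_s phi (comp1 X) s t
      + along_s phi (comp2 X) s t * along_s phi (comp2 X) s t
      + along_s phi (comp3 X) s t * along_s phi (comp3 X) s t).
    + unfold E, F', G, a1, b1, along_s, along, gE, gF, gG, dot3, Du3, Dv3.
      cbn [c1 c2 c3 fst snd].
      unfold comp1, comp2, comp3; cbn [c1 c2 c3 fst snd]; ring.
    + rewrite A1, A2, A3.
      transitivity (drho s * drho s * (sin t * sin t + cos t * cos t) + dzeta s * dzeta s);
        [ring |].
      rewrite Q, T1, T2.
      transitivity (v s * v s * (C s * C s + S s * S s)); [ring | rewrite U; ring].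
  - transitivity (along_s phi (comp1 X) s t * along_t phi (comp1 X) s t
      + along_s phi (comp2 X) s t * along_t phi (comp2 X) s t
      + along_s phi (comp3 X) s t * along_t phi (comp3 X) s t).
    + unfold E, F', G, a1, b1, a2, b2, along_s, along_t, along, gE, gF, gG, dot3, Du3, Dv3.
      cbn [c1 c2 c3 fst snd].
      unfold comp1, comp2, comp3; cbn [c1 c2 c3 fst snd]; ring.
    + rewrite A1, A2, A3, B1, B2, B3; ring.
  - transitivity (along_t phi (comp1 X) s t * along_t phi (comp1 X) s t
      + along_t phi (comp2 X) s t * along_t phi (comp2 X) s t
      + along_t phi (comp3 X) s t * along_t phi (comp3 X) s t).
    + unfold E, F', G, a2, b2, along_t, along, gE, gF, gG, dot3, Du3, Dv3.
      cbn [c1 c2 c3 fst snd].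
      unfold comp1, comp2, comp3; cbn [c1 c2 c3 fst snd]; ring.
    + rewrite B1, B2, B3.
      transitivity (rho s * rho s * (sin t * sin t + cos t * cos t)); [ring |].
      rewrite Q; ring.
Qed.

Lemma polar_jac_nonzero s t : 0 < s <= 1 -> s * polar (jac phi) s t <> 0.
Proof.
  intros Hs; apply Rmult_integral_contrapositive_currified; [lra |].
  apply (jac_nonzero phi Hphi), closed_disc_polar; lra.
Qed.

Lemma along_curvatures s t : 0 < s < 1 ->
  let k := (C s * dS s - S s * dC s) / v s in
  along phi (mean_curvature X) s t = (k + S s / rho s) / 2 /\
  along phi (gauss_curvature X) s t = k * (S s / rho s).
Proof.
  intros Hs k.
  destruct (along_s_position s t) as (A1 & A2 & A3); [lra |].
  destruct (along_t_position s t) as (B1 & B2 & B3); [lra |].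
  destruct (along_s_normal s t Hs) as (N1 & N2 & N3).
  destruct (along_t_normal s t Hs) as (M1 & M2 & M3).
  destruct (profile_tangent s Hs) as (T1 & T2).
  destruct (metric_polar s t Hs) as (ME & MF & MG).
  assert (Q := sin2_cos2 t); unfold Rsqr in Q.
  assert (Hr := rho_nonzero s ltac:(lra)).
  assert (Hv := v_nonzero s Hs).
  assert (Hg := gdet_pos X HX _ _ (along_closed phi Hphi s t ltac:(lra))).
  fold (along phi (gdet X) s t) in Hg.
  set (b11 := along phi (Du (comp1 (normal X))) s t * along phi (Du (comp1 X)) s t
            + along phi (Du (comp2 (normal X))) s t * along phi (Du (comp2 X)) s t
            + along phi (Du (comp3 (normal X))) s t * along phi (Du (comp3 X)) s t).
  set (b12 := along phi (Du (comp1 (normal X))) s t * along phi (Dv (comp1 X)) s t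
            + along phi (Du (comp2 (normal X))) s t * along phi (Dv (comp2 X)) s t
            + along phi (Du (comp3 (normal X))) s t * along phi (Dv (comp3 X)) s t).
  set (b21 := along phi (Dv (comp1 (normal X))) s t * along phi (Du (comp1 X)) s t
            + along phi (Dv (comp2 (normal X))) s t * along phi (Du (comp2 X)) s t
            + along phi (Dv (comp3 (normal X))) s t * along phi (Du (comp3 X)) s t).
  set (b22 := along phi (Dv (comp1 (normal X))) s t * along phi (Dv (comp1 X)) s t
            + along phi (Dv (comp2 (normal X))) s t * along phi (Dv (comp2 X)) s t
            + along phi (Dv (comp3 (normal X))) s t * along phi (Dv (comp3 X)) s t).
  destruct (shape_operator_invariance
    (polar_s (px phi) s t) (polar_s (py phi) s t)
    (polar_t (px phi) s t) (polar_t (py phi) s t)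
    (along phi (gE X) s t) (along phi (gF X) s t) (along phi (gG X) s t)
    b11 b12 b21 b22) as [EH EK].
  { rewrite polar_jac; apply polar_jac_nonzero; lra. }
  { apply Rgt_not_eq, Hg. }
  change (along phi (mean_curvature X) s t) with
    (- (1 / 2) * ((b11 * along phi (gG X) s t - (b12 + b21) * along phi (gF X) s t
                   + b22 * along phi (gE X) s t)
       / (along phi (gE X) s t * along phi (gG X) s t - along phi (gF X) s t ^ 2))).
  change (along phi (gauss_curvature X) s t) with
    ((b11 * b22 - b12 * b21)
       / (along phi (gE X) s t * along phi (gG X) s t - along phi (gF X) s t ^ 2)).
  rewrite EH, EK; clear EH EK.
  rewrite ME, MF, MG.
  match goal with |- context [(?x11 * (rho s * rho s) - (?x12 + ?x21) * 0 + ?x22 * _)] =>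
    assert (E11 : x11 = v s * (S s * dC s - C s * dS s));
    [| assert (E12 : x12 = 0); [| assert (E21 : x21 = 0);
       [| assert (E22 : x22 = - (S s * rho s)); [| rewrite E11, E12, E21, E22]]]]
  end.
  - transitivity (along_s phi (comp1 (normal X)) s t * along_s phi (comp1 X) s t
      + along_s phi (comp2 (normal X)) s t * along_s phi (comp2 X) s t
      + along_s phi (comp3 (normal X)) s t * along_s phi (comp3 X) s t).
    + unfold b11, b12, b21, b22, along_s; ring.
    + rewrite A1, A2, A3, N1, N2, N3, T1, T2.
      transitivity (v s * (S s * dC s - C s * dS s * (sin t * sin t + cos t * cos t)));
        [ring | rewrite Q; ring].
  - transitivity (along_s phi (comp1 (normal X)) s t * along_t phi (comp1 X) s t
      + along_s phi (comp2 (normal X)) s t * along_t phi (comp2 X) s t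
      + along_s phi (comp3 (normal X)) s t * along_t phi (comp3 X) s t).
    + unfold b11, b12, b21, b22, along_s, along_t; ring.
    + rewrite B1, B2, B3, N1, N2, N3; ring.
  - transitivity (along_t phi (comp1 (normal X)) s t * along_s phi (comp1 X) s t
      + along_t phi (comp2 (normal X)) s t * along_s phi (comp2 X) s t
      + along_t phi (comp3 (normal X)) s t * along_s phi (comp3 X) s t).
    + unfold b11, b12, b21, b22, along_s, along_t; ring.
    + rewrite A1, A2, A3, M1, M2, M3; ring.
  - transitivity (along_t phi (comp1 (normal X)) s t * along_t phi (comp1 X) s t
      + along_t phi (comp2 (normal X)) s t * along_t phi (comp2 X) s t
      + along_t phi (comp3 (normal X)) s t * along_t phi (comp3 X) s t).
    + unfold b11, b12, b21, b22, along_t; ring.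
    + rewrite B1, B2, B3, M1, M2, M3.
      transitivity (- (S s * rho s) * (sin t * sin t + cos t * cos t));
        [ring | rewrite Q; ring].
  - unfold k; split; field; auto.
Qed.

Lemma mean_curvature_rotation s t : 0 < s < 1 -> along phi (mean_curvature X) s t = F s.
Proof.
  intros Hs; unfold F.
  rewrite (proj1 (along_curvatures s t Hs)), (proj1 (along_curvatures s 0 Hs)).
  reflexivity.
Qed.

(** Differentiating C^2 + S^2 = 1 shows that (C, S) rotates with angular
    velocity v times the meridian curvature. *)
Lemma frenet s : 0 < s < 1 ->
  dC s = - (v s * (2 * F s - S s / rho s) * S s) /\
  dS s = v s * (2 * F s - S s / rho s) * C s /\
  K s = (2 * F s - S s / rho s) * (S s / rho s).
Proof.
  intros Hs.
  destruct (along_curvatures s 0 Hs) as [EF EK].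
  fold (F s) in EF; fold (K s) in EK; rewrite EF, EK.
  assert (Hv := v_nonzero s Hs).
  assert (Hr := rho_nonzero s ltac:(lra)).
  assert (U := profile_unit s Hs).
  assert (HD : C s * dC s + S s * dS s = 0).
  { pose proof (C_derive s ltac:(lra)); pose proof (S_derive s ltac:(lra)).
    assert (E : dC s * C s + C s * dC s + (dS s * S s + S s * dS s) = 0); [| lra].
    apply (derive_eq_on (fun s => C s * C s + S s * S s) (fun _ => 1) 0 1 s);
      [exact Hs | exact profile_unit | der; ring | apply der_const]. }
  set (k := (C s * dS s - S s * dC s) / v s).
  assert (Hk : v s * k = C s * dS s - S s * dC s) by (unfold k; field; exact Hv).
  replace (2 * ((k + S s / rho s) / 2) - S s / rho s) with k by (field; exact Hr).
  rewrite Hk; split; [| split]; [| | ring].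
  - transitivity (dC s * (C s * C s + S s * S s)); [rewrite U; ring |].
    transitivity (C s * (C s * dC s + S s * dS s) - (C s * dS s - S s * dC s) * S s);
      [ring | rewrite HD; ring].
  - transitivity (dS s * (C s * C s + S s * S s)); [rewrite U; ring |].
    transitivity (S s * (C s * dC s + S s * dS s) + (C s * dS s - S s * dC s) * C s);
      [ring | rewrite HD; ring].
Qed.

(** The two components of [sqrt g * grad H], whose divergence is
    [sqrt g * Delta H]. *)
Let Vu x y :=
  (gG X x y * Du (mean_curvature X) x y - gF X x y * Dv (mean_curvature X) x y)
  / sqrt (gdet X x y).
Let Vv x y :=
  (gE X x y * Dv (mean_curvature X) x y - gF X x y * Du (mean_curvature X) x y)
  / sqrt (gdet X x y).

Lemma flux_Ck x y : closed_disc x y -> Ck 1 Vu x y /\ Ck 1 Vv x y.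
Proof.
  intros Hc.
  destruct (metric_Ck X HX x y Hc) as (HE & HF & HG & HD).
  destruct (curvature_Ck X HX x y Hc) as (CH & _).
  assert (Hg := gdet_pos X HX x y Hc).
  assert (Ks := Ck_sqrt 3 _ _ _ HD Hg).
  assert (Hs := Rgt_not_eq _ _ (sqrt_lt_R0 _ Hg)).
  unfold Vu, Vv; split; ck; try (apply (Ck_le 3); [lia | exact Ks]); exact Hs.
Qed.

(** The flux of [grad H] through the coordinate lines.  Since [H] is constant
    along the parallels and these are orthogonal to the meridians, only the
    flux through the parallels is nonzero. *)
Lemma flux_polar s t : 0 < s < 1 ->
  along phi Vu s t * polar_t (py phi) s t - along phi Vv s t * polar_t (px phi) s t
    = rho s / v s * dF s /\
  along phi Vv s t * polar_s (px phi) s t - along phi Vu s t * polar_s (py phi) s t = 0.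
Proof.
  intros Hs.
  destruct (metric_polar s t Hs) as (ME & MF & MG).
  assert (Hr := rho_nonzero s ltac:(lra)).
  assert (Hv := v_nonzero s Hs).
  assert (HJ := polar_jac_nonzero s t ltac:(lra)).
  assert (Hg := gdet_pos X HX _ _ (along_closed phi Hphi s t ltac:(lra))).
  fold (along phi (gdet X) s t) in Hg.
  assert (HD := Rgt_not_eq _ _ (sqrt_lt_R0 _ Hg)).
  assert (HJD : s * polar (jac phi) s t * sqrt (along phi (gdet X) s t) = rho s * v s).
  { rewrite <- m_velocity, <- (m_rotation s t) by exact Hs.
    unfold m; f_equal; unfold along, norm3; f_equal; apply gdet_cross. }
  destruct (along_Ck s t ltac:(lra)) as (_ & _ & _ & _ & _ & _ & CH & _).
  destruct (along_Ck s 0 ltac:(lra)) as (_ & _ & _ & _ & _ & _ & CH0 & _).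
  assert (Fs : along_s phi (mean_curvature X) s t = dF s).
  { apply (derive_eq_on (fun x => along phi (mean_curvature X) x t) F 0 1 s);
      [exact Hs | exact (fun x Hx => mean_curvature_rotation x t Hx) | |];
      apply (along_derive_s phi Hphi); try lra; ck. }
  assert (Ft : along_t phi (mean_curvature X) s t = 0).
  { apply (derive_eq_on (fun x => along phi (mean_curvature X) s x) (fun _ => F s)
             (t - 1) (t + 1) t);
      [lra | exact (fun x _ => mean_curvature_rotation s x Hs)
      | apply (along_derive_t phi Hphi); [lra | ck] | apply der_const]. }
  change (along phi Vu s t) with
    ((along phi (gG X) s t * along phi (Du (mean_curvature X)) s t
      - along phi (gF X) s t * along phi (Dv (mean_curvature X)) s t)
     / sqrt (along phi (gdet X) s t)).
  change (along phi Vv s t) with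
    ((along phi (gE X) s t * along phi (Dv (mean_curvature X)) s t
      - along phi (gF X) s t * along phi (Du (mean_curvature X)) s t)
     / sqrt (along phi (gdet X) s t)).
  rewrite <- polar_jac in HJD, HJ.
  unfold along_s in Fs; unfold along_t in Ft.
  revert ME MF MG HJD HD HJ Fs Ft.
  generalize (sqrt (along phi (gdet X) s t)) (along phi (gE X) s t)
    (along phi (gF X) s t) (along phi (gG X) s t)
    (along phi (Du (mean_curvature X)) s t) (along phi (Dv (mean_curvature X)) s t)
    (polar_s (px phi) s t) (polar_s (py phi) s t)
    (polar_t (px phi) s t) (polar_t (py phi) s t).
  intros D E F' G fu fv a1 b1 a2 b2 ME MF MG HJD HD HJ Fs Ft.
  (* The partial derivatives of H by Cramer's rule *)
  assert (Eu : (a1 * b2 - a2 * b1) * fu = dF s * b2).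
  { rewrite <- Fs.
    transitivity ((fu * a1 + fv * b1) * b2 - (fu * a2 + fv * b2) * b1);
      [ring | rewrite Ft; ring]. }
  assert (Ev : (a1 * b2 - a2 * b1) * fv = - (dF s * a2)).
  { rewrite <- Fs.
    transitivity ((fu * a2 + fv * b2) * a1 - (fu * a1 + fv * b1) * a2);
      [ring | rewrite Ft; ring]. }
  split; apply Rmult_eq_reg_l with (2 := Rmult_integral_contrapositive_currified _ _ HJ HD).
  - rewrite HJD at 2.
    transitivity ((G * ((a1 * b2 - a2 * b1) * fu) - F' * ((a1 * b2 - a2 * b1) * fv)) * b2
      - (E * ((a1 * b2 - a2 * b1) * fv) - F' * ((a1 * b2 - a2 * b1) * fu)) * a2);
      [field; exact HD |].
    rewrite Eu, Ev.
    transitivity (dF s * (a2 * a2 * E + 2 * (a2 * b2) * F' + b2 * b2 * G)); [ring |].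
    rewrite MG; field; auto.
  - transitivity ((E * ((a1 * b2 - a2 * b1) * fv) - F' * ((a1 * b2 - a2 * b1) * fu)) * a1
      - (G * ((a1 * b2 - a2 * b1) * fu) - F' * ((a1 * b2 - a2 * b1) * fv)) * b1);
      [field; exact HD |].
    rewrite Eu, Ev.
    transitivity (- dF s * (a1 * a2 * E + (a1 * b2 + b1 * a2) * F' + b1 * b2 * G)); [ring |].
    rewrite MF; ring.
Qed.

(** Invariance of the divergence under the change of coordinates: the second
    derivatives of [phi] cancel by symmetry. *)
Lemma flux_divergence s : 0 < s < 1 ->
  is_derive (fun s => rho s / v s * dF s) s
    (rho s * v s * along phi (laplacian X (mean_curvature X)) s 0).
Proof.
  intros Hs; assert (Hs' : -1 <= s <= 1) by lra.
  destruct (flux_Ck _ _ (along_closed phi Hphi s 0 Hs')) as [KU KV].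
  destruct (phi_Ck phi Hphi _ _ (closed_disc_polar s 0 Hs')) as [Ka Kb].
  destruct (polar_symmetric (px phi) s Hs') as (la & Ha1 & Ha2); [ck |].
  destruct (polar_symmetric (py phi) s Hs') as (lb & Hb1 & Hb2); [ck |].
  pose proof (along_derive_s phi Hphi Vu s 0 Hs' KU) as U1.
  pose proof (along_derive_t phi Hphi Vu s 0 Hs' KU) as U2.
  pose proof (along_derive_s phi Hphi Vv s 0 Hs' KV) as V1.
  pose proof (along_derive_t phi Hphi Vv s 0 Hs' KV) as V2.
  apply is_derive_ext_loc with (fun s =>
    along phi Vu s 0 * polar_t (py phi) s 0 - along phi Vv s 0 * polar_t (px phi) s 0).
  { apply (locally_open_interval 0 1); [exact Hs |].
    intros x Hx; apply flux_polar, Hx. }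
  assert (HT : (along_t phi Vv s 0 * polar_s (px phi) s 0 + along phi Vv s 0 * la)
    - (along_t phi Vu s 0 * polar_s (py phi) s 0 + along phi Vu s 0 * lb) = 0).
  { apply (derive_eq_on (fun t => along phi Vv s t * polar_s (px phi) s t
                             - along phi Vu s t * polar_s (py phi) s t) (fun _ => 0)
             (-1) 1 0); [lra | | der; ring | apply der_const].
    intros t Ht; apply flux_polar, Hs. }
  assert (HL : sqrt (along phi (gdet X) s 0) * along phi (laplacian X (mean_curvature X)) s 0
               = along phi (Du Vu) s 0 + along phi (Dv Vv) s 0).
  { change (along phi (laplacian X (mean_curvature X)) s 0) with
      (/ sqrt (along phi (gdet X) s 0) * (along phi (Du Vu) s 0 + along phi (Dv Vv) s 0)).
    field; apply Rgt_not_eq, sqrt_lt_R0.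
    apply (gdet_pos X HX _ _ (along_closed phi Hphi s 0 Hs')). }
  assert (HJD : s * polar (jac phi) s 0 * sqrt (along phi (gdet X) s 0) = rho s * v s).
  { rewrite <- m_velocity by exact Hs.
    unfold m; f_equal; unfold along, norm3; f_equal; apply gdet_cross. }
  der.
  rewrite <- HJD, Rmult_assoc, HL, <- polar_jac.
  revert HT; unfold along_s, along_t.
  generalize (along phi (Du Vu) s 0) (along phi (Dv Vu) s 0) (along phi (Du Vv) s 0)
    (along phi (Dv Vv) s 0) (along phi Vu s 0) (along phi Vv s 0)
    (polar_s (px phi) s 0) (polar_s (py phi) s 0)
    (polar_t (px phi) s 0) (polar_t (py phi) s 0).
  intros; lra.
Qed.

Lemma revolution_profile_eqs c0 :
  helfrich_critical c0 X -> profile_eqs c0 rho zeta v C S F dF K.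
Proof.
  intros HEL.
  assert (cH : forall s, -1 <= s <= 1 -> Ck 1 (mean_curvature X) (polar (px phi) s 0) (polar (py phi) s 0)).
  { intros s Hs; destruct (along_Ck s 0 Hs) as (_ & _ & _ & _ & _ & _ & CH & _); ck. }
  assert (crho : forall s, -1 <= s <= 1 -> continuity_pt rho s)
    by (intros s Hs; apply (der_continuous _ _ _ (rho_derive s Hs))).
  assert (czeta : forall s, -1 <= s <= 1 -> continuity_pt zeta s)
    by (intros s Hs; apply (der_continuous _ _ _ (zeta_derive s Hs))).
  assert (cC : forall s, -1 <= s <= 1 -> continuity_pt C s)
    by (intros s Hs; apply (der_continuous _ _ _ (C_derive s Hs))).
  assert (cS : forall s, -1 <= s <= 1 -> continuity_pt S s)
    by (intros s Hs; apply (der_continuous _ _ _ (S_derive s Hs))).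
  assert (hF : forall s, -1 <= s <= 1 -> is_derive F s (dF s))
    by (intros s Hs; apply (along_derive_s phi Hphi); [exact Hs | auto]).
  assert (cdrho : forall s, -1 <= s <= 1 -> continuity_pt drho s).
  { intros s Hs; destruct (along_Ck s 0 Hs) as (K1 & _).
    apply along_s_continuous; [exact Hs | ck]. }
  assert (cdzeta : forall s, -1 <= s <= 1 -> continuity_pt dzeta s).
  { intros s Hs; destruct (along_Ck s 0 Hs) as (_ & _ & K1 & _).
    apply along_s_continuous; [exact Hs | ck]. }
  assert (cv : forall s, -1 <= s <= 1 -> continuity_pt v s).
  { intros s Hs; specialize (cdrho s Hs); specialize (cdzeta s Hs).
    specialize (cC s Hs); specialize (cS s Hs); unfold v; cont. }
  assert (T0 : drho 0 = v 0 * C 0 /\ dzeta 0 = v 0 * S 0).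
  { split.
    - apply Rminus_diag_uniq.
      apply (zero_on_closure (fun s => drho s - v s * C s)); [| | lra].
      + intros s Hs; specialize (cdrho s ltac:(lra)); specialize (cC s ltac:(lra)).
        specialize (cv s ltac:(lra)); cont.
      + intros s Hs; destruct (profile_tangent s Hs); lra.
    - apply Rminus_diag_uniq.
      apply (zero_on_closure (fun s => dzeta s - v s * S s)); [| | lra].
      + intros s Hs; specialize (cdzeta s ltac:(lra)); specialize (cS s ltac:(lra)).
        specialize (cv s ltac:(lra)); cont.
      + intros s Hs; destruct (profile_tangent s Hs); lra. }
  assert (v0 : v 0 <> 0).
  { intros E; apply drho_0; rewrite (proj1 T0), E; ring. }
  constructor.
  - apply rho_0.
  - destruct T0 as [_ T0]; rewrite dzeta_0 in T0.
    symmetry in T0; apply Rmult_integral in T0; tauto.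
  - exact v0.
  - exists (drho 0); split; [apply drho_0 | apply rho_derive; lra].
  - intros s Hs; apply crho; lra.
  - intros s Hs; apply czeta; lra.
  - intros s Hs; apply cC; lra.
  - intros s Hs; apply cS; lra.
  - intros s Hs; apply (der_continuous _ _ _ (hF s ltac:(lra))).
  - intros s Hs; apply cv; lra.
  - intros s Hs; apply along_s_continuous; [lra | apply cH; lra].
  - intros s Hs; apply (along_continuous phi Hphi); [lra |].
    destruct (along_Ck s 0 ltac:(lra)) as (_ & _ & _ & _ & _ & _ & _ & CK).
    apply (Ck_continuous 2), CK.
  - exact rho_nonzero.
  - exact v_nonzero.
  - exact profile_unit.
  - intros s Hs; rewrite <- (proj1 (profile_tangent s Hs)); apply rho_derive; lra.
  - intros s Hs; rewrite <- (proj2 (profile_tangent s Hs)); apply zeta_derive; lra.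
  - intros s Hs; rewrite <- (proj1 (frenet s Hs)); apply C_derive; lra.
  - intros s Hs; rewrite <- (proj1 (proj2 (frenet s Hs))); apply S_derive; lra.
  - intros s Hs; apply (frenet s Hs).
  - intros s Hs; apply hF; lra.
  - intros s Hs; eapply der_eq; [apply flux_divergence, Hs |].
    assert (E := HEL _ _ (along_open phi Hphi s 0 ltac:(lra))).
    cbv zeta in E.
    fold (along phi (laplacian X (mean_curvature X)) s 0) in E.
    fold (along phi (mean_curvature X) s 0) in E.
    fold (along phi (gauss_curvature X) s 0) in E.
    fold (F s) in E; fold (K s) in E.
    replace (along phi (laplacian X (mean_curvature X)) s 0) with
      (- (2 * (F s + c0) * (F s * (F s - c0) - K s))) by lra.
    ring.
Qed.

(** * The three cases *)

Lemma closed_disc_along u w : closed_disc u w ->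
  exists s t, 0 <= s <= 1 /\ u = polar (px phi) s t /\ w = polar (py phi) s t.
Proof.
  intros Hc; destruct Hphi as (_ & _ & _ & _ & Hsurj & _).
  destruct (Hsurj u w Hc) as (u' & w' & Hc' & E).
  destruct (closed_disc_polar_inv u' w' Hc') as (s & t & Hs & -> & ->).
  exists s, t; split; [exact Hs |].
  unfold polar, px, py; rewrite E; split; reflexivity.
Qed.

Lemma position_polar s t : 0 <= s <= 1 ->
  X (polar (px phi) s t) (polar (py phi) s t) = (rho s * cos t, rho s * sin t, zeta s).
Proof.
  intros Hs; destruct (along_position s t) as (E1 & E2 & E3); [lra |].
  rewrite <- E1, <- E2, <- E3; unfold along, comp1, comp2, comp3.
  destruct (X _ _) as [[a b] c]; reflexivity.
Qed.

(** A set invariant under rotation is parametrised as soon as its trace in the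
    half-plane of squared radii and heights is parametrised by the profile. *)
Lemma revolution_parametrises (A : vec3 -> Prop) :
  (forall s t, 0 <= s <= 1 -> A (rho s * cos t, rho s * sin t, zeta s)) ->
  (forall s s', 0 <= s <= 1 -> 0 <= s' <= 1 ->
     rho s * rho s = rho s' * rho s' -> zeta s = zeta s' -> s = s') ->
  (forall p, A p -> exists s, 0 <= s <= 1 /\ zeta s = c3 p /\
     c1 p * c1 p + c2 p * c2 p = rho s * rho s) ->
  parametrises X A.
Proof.
  intros HA Hinj Hsurj; split; [| split].
  - intros u w Hc; destruct (closed_disc_along u w Hc) as (s & t & Hs & -> & ->).
    rewrite position_polar by exact Hs; apply HA, Hs.
  - intros p Hp; destruct (Hsurj p Hp) as (s & Hs & Ez & Er).
    destruct (angle_exists_scaled _ _ _ Er) as (t & E1 & E2).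
    exists (polar (px phi) s t), (polar (py phi) s t); split.
    + apply (along_closed phi Hphi); lra.
    + rewrite position_polar, <- E1, <- E2, Ez by exact Hs.
      destruct p as [[a b] c]; reflexivity.
  - intros u w u' w' Hc Hc' E.
    destruct (closed_disc_along u w Hc) as (s & t & Hs & -> & ->).
    destruct (closed_disc_along u' w' Hc') as (s' & t' & Hs' & -> & ->).
    rewrite !position_polar in E by assumption.
    injection E as E1 E2 E3.
    assert (Q := sin2_cos2 t); assert (Q' := sin2_cos2 t'); unfold Rsqr in Q, Q'.
    assert (Hss : s = s').
    { apply Hinj; try assumption.
      transitivity ((rho s * cos t) * (rho s * cos t) + (rho s * sin t) * (rho s * sin t)).
      - transitivity (rho s * rho s * (sin t * sin t + cos t * cos t));
          [rewrite Q |]; ring.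
      - rewrite E1, E2.
        transitivity (rho s' * rho s' * (sin t' * sin t' + cos t' * cos t'));
          [| rewrite Q']; ring. }
    subst s'; destruct (Req_dec s 0) as [-> | Hne].
    + unfold polar; rewrite !Rmult_0_l; reflexivity.
    + assert (Hr := rho_nonzero s ltac:(lra)).
      apply Rmult_eq_reg_l in E1; [| exact Hr].
      apply Rmult_eq_reg_l in E2; [| exact Hr].
      unfold polar; rewrite E1, E2; reflexivity.
Qed.

Lemma on_closed_disc (g : R -> R -> R) :
  (forall u w, closed_disc u w -> continuity_2d_pt g u w) ->
  (forall s t, 0 < s < 1 -> along phi g s t = 0) ->
  forall u w, closed_disc u w -> g u w = 0.
Proof.
  intros Hg H u w Hc; destruct (closed_disc_along u w Hc) as (s & t & Hs & -> & ->).
  apply (zero_on_closure (fun s => along phi g s t)); [| | exact Hs].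
  - intros x Hx; apply (along_continuous phi Hphi); [lra |].
    apply Hg, (along_closed phi Hphi); lra.
  - intros x Hx; apply H, Hx.
Qed.

Context (c0 : R) (HEL : helfrich_critical c0 X).

(** Here w = f, that is l = 0 and m = 1 in [profile_linear]. *)
Lemma cmc_disc : F 0 + c0 = 0 ->
  (forall s, 0 <= s <= 1 -> F s = - c0) /\
  (forall u w, closed_disc u w -> mean_curvature X u w = - c0).
Proof.
  intros H0.
  assert (HF : forall s, 0 <= s <= 1 -> F s = - c0).
  { intros s Hs.
    assert (E := profile_linear _ _ _ _ _ _ _ _ _ 0 1 (revolution_profile_eqs c0 HEL)
                   ltac:(rewrite H0; ring) s Hs).
    lra. }
  split; [exact HF |].
  intros u w Hc; apply Rminus_diag_uniq; revert u w Hc.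
  apply (on_closed_disc (fun u w => mean_curvature X u w - - c0)).
  - intros u w Hc; apply continuity_2d_pt_minus; [| apply continuity_2d_pt_const].
    apply (Ck_continuous 2), (curvature_Ck X HX u w Hc).
  - intros s t Hs.
    change (along phi (mean_curvature X) s t - - c0 = 0).
    rewrite mean_curvature_rotation, HF by lra; ring.
Qed.

Lemma planar_case : c0 = 0 -> F 0 + c0 = 0 -> planar_disc X.
Proof.
  intros Hc0 H0.
  destruct (cmc_disc H0) as [HF _].
  assert (HE := revolution_profile_eqs c0 HEL).
  rewrite Hc0 in HE, HF.
  destruct (planar_profile _ _ _ _ _ _ _ _ HE HF) as [Hz Hinj].
  assert (Hr1 := rho_nonzero 1 ltac:(lra)).
  assert (Hcont : forall s, 0 <= s <= 1 -> continuity_pt (fun s => rho s * rho s) s).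
  { intros s Hs; pose proof (pe_crho HE Hs); cont. }
  assert (Hrr : rho 0 * rho 0 < rho 1 * rho 1) by (rewrite rho_0; nra).
  assert (Hbetween := injective_between _ Hcont Hinj Hrr).
  assert (Habs : Rabs (rho 1) * Rabs (rho 1) = rho 1 * rho 1)
    by (rewrite <- Rabs_mult; apply Rabs_right; nra).
  exists (0, 0, zeta 0), (0, 0, 1), (Rabs (rho 1)).
  split; [| split].
  - apply norm3_eq_iff; [lra |]; unfold dot3, c1, c2, c3; simpl; ring.
  - apply Rabs_pos_lt, Hr1.
  - apply revolution_parametrises.
    + intros s t Hs; split.
      * unfold dot3, sub3, c1, c2, c3; simpl; rewrite (Hz s Hs); ring.
      * apply norm3_le_iff; [apply Rabs_pos |].
        unfold dot3, sub3, c1, c2, c3; simpl; rewrite (Hz s Hs), Habs.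
        assert (Q := sin2_cos2 t); unfold Rsqr in Q.
        apply Rle_trans with (rho s * rho s * (sin t * sin t + cos t * cos t));
          [right; ring |].
        rewrite Q, Rmult_1_r; apply (Hbetween s Hs).
    + intros s s' Hs Hs' E _; apply Hinj; assumption.
    + intros [[a b] c] [E1 E2].
      apply norm3_le_iff in E2; [| apply Rabs_pos]; rewrite Habs in E2.
      unfold dot3, sub3, c1, c2, c3 in *; simpl in *.
      destruct (intermediate_value (fun s => rho s * rho s) 0 1 (a * a + b * b))
        as (s & Hs & Es); [lra | exact Hcont | |].
      * rewrite rho_0; nra.
      * exists s; split; [exact Hs |]; rewrite (Hz s Hs); split; [lra | auto].
Qed.

Lemma spherical_case : c0 <> 0 -> F 0 + c0 = 0 -> spherical_cap X.
Proof.
  intros Hc0 H0.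
  destruct (cmc_disc H0) as [HF _].
  assert (HE := revolution_profile_eqs c0 HEL).
  destruct (spherical_profile _ _ _ _ _ _ _ _ _ Hc0 HE HF) as (k & Hk & Hinj).
  set (rad := / Rabs c0) in *.
  assert (Hrad : 0 < rad) by apply Rinv_0_lt_compat, Rabs_pos_lt, Hc0.
  assert (E0 := Hk 0 ltac:(lra)); rewrite rho_0 in E0.
  assert (E1 := Hk 1 ltac:(lra)).
  assert (Hr1 := rho_nonzero 1 ltac:(lra)).
  (* The cap is centred at the pole where the profile starts, [sg] being its
     side. *)
  set (sg := (zeta 0 - k) / rad).
  assert (Hsg : sg * sg = 1).
  { unfold sg; transitivity (((zeta 0 - k) * (zeta 0 - k)) / (rad * rad)); [field; lra |].
    replace ((zeta 0 - k) * (zeta 0 - k)) with (rad * rad) by lra; field; lra. }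
  set (g := fun s => - (sg * (zeta s - k))).
  assert (Hg0 : g 0 = - rad).
  { unfold g; replace (zeta 0 - k) with (sg * rad) by (unfold sg; field; lra).
    transitivity (- (sg * sg * rad)); [ring | rewrite Hsg; ring]. }
  assert (Hgsq : forall x, (sg * x) * (sg * x) = x * x).
  { intros x; transitivity (sg * sg * (x * x)); [ring | rewrite Hsg; ring]. }
  assert (Hg1 : - rad < g 1 < rad).
  { assert (g 1 * g 1 < rad * rad); [| split; nra].
    unfold g; rewrite Rmult_opp_opp, Hgsq; nra. }
  assert (Hcont : forall s, 0 <= s <= 1 -> continuity_pt g s).
  { intros s Hs; pose proof (pe_czeta HE Hs); unfold g; cont. }
  assert (Hginj : forall s s', 0 <= s <= 1 -> 0 <= s' <= 1 -> g s = g s' -> s = s').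
  { intros s s' Hs Hs' E; apply Hinj; try assumption.
    unfold g in E.
    assert (E' : sg * sg * (zeta s - k) = sg * sg * (zeta s' - k)).
    { rewrite !Rmult_assoc; f_equal; lra. }
    rewrite Hsg in E'; lra. }
  assert (Hbetween := injective_between g Hcont Hginj ltac:(lra)).
  exists (0, 0, k), (0, 0, sg), rad, (- g 1).
  split; [| split; [exact Hrad | split; [lra |]]].
  - apply norm3_eq_iff; [lra |]; unfold dot3, c1, c2, c3; simpl; lra.
  - apply revolution_parametrises.
    + intros s t Hs; split.
      * apply norm3_eq_iff; [lra |].
        unfold dot3, sub3, c1, c2, c3; simpl.
        assert (Q := sin2_cos2 t); unfold Rsqr in Q.
        rewrite <- (Hk s Hs).
        transitivity (rho s * rho s * (sin t * sin t + cos t * cos t)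
          + (zeta s - k) * (zeta s - k)); [ring | rewrite Q; ring].
      * unfold dot3, sub3, c1, c2, c3; simpl.
        destruct (Hbetween s Hs) as [_ Hb].
        unfold g in Hb at 1; lra.
    + intros s s' Hs Hs' _ E; apply Hinj; assumption.
    + intros [[a b] c] [Ea Eb].
      apply norm3_eq_iff in Ea; [| lra].
      unfold dot3, sub3, c1, c2, c3 in *; simpl in *.
      assert (Hle : sg * (c - k) <= rad).
      { assert (E := Hgsq (c - k)); nra. }
      destruct (intermediate_value g 0 1 (- (sg * (c - k)))) as (s & Hs & Es);
        [lra | exact Hcont | lra |].
      assert (Ez : zeta s = c).
      { unfold g in Es.
        assert (E' : sg * sg * (zeta s - k) = sg * sg * (c - k)).
        { rewrite !Rmult_assoc; f_equal; lra. }
        rewrite Hsg in E'; lra. }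
      exists s; split; [exact Hs | split; [exact Ez |]].
      assert (Es' := Hk s Hs); rewrite Ez in Es'; lra.
Qed.

Lemma Derive_plus_const (f : R -> R) (a x : R) :
  Derive (fun t => f t + a) x = Derive f x.
Proof.
  unfold Derive; f_equal; apply Lim_ext; intros y; unfold Rdiv; ring.
Qed.

Lemma Du3_translate t : Du3 (translate_z t X) = Du3 X.
Proof.
  extensionality u; extensionality w.
  unfold Du3, Du; apply f_equal2; [apply f_equal2 |];
    exact (Derive_plus_const _ _ _).
Qed.

Lemma Dv3_translate t : Dv3 (translate_z t X) = Dv3 X.
Proof.
  extensionality u; extensionality w.
  unfold Dv3, Dv; apply f_equal2; [apply f_equal2 |];
    exact (Derive_plus_const _ _ _).
Qed.

Lemma normal_translate t : normal (translate_z t X) = normal X.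
Proof. unfold normal; rewrite Du3_translate, Dv3_translate; reflexivity. Qed.

Lemma mean_curvature_translate t : mean_curvature (translate_z t X) = mean_curvature X.
Proof.
  unfold mean_curvature, gdet, gE, gF, gG.
  rewrite normal_translate, Du3_translate, Dv3_translate; reflexivity.
Qed.

(** Take l = 1 and m = a in [profile_linear], with a such that w vanishes at
    the centre; a is the vertical translation. *)
Lemma reduced_membrane_case : F 0 + c0 <> 0 -> exists t, reduced_membrane c0 (translate_z t X).
Proof.
  intros H0.
  set (a := - (C 0 + (F 0 + c0) * zeta 0) / (F 0 + c0)).
  exists a; intros u w Hc.
  rewrite normal_translate, mean_curvature_translate.
  apply Rminus_diag_uniq; revert u w Hc.
  apply on_closed_disc.
  - intros u w Hc.
    destruct (immersion_Ck X HX u w Hc) as (_ & _ & K3).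
    destruct (normal_Ck X HX u w Hc) as (_ & _ & N3).
    destruct (curvature_Ck X HX u w Hc) as (CH & _).
    apply (Ck_continuous 2).
    apply (Ck_ext 2 (fun u w => (mean_curvature X u w + c0) * (c3 (X u w) + a)
                                + c3 (normal X u w))).
    + intros u' w'; unfold translate_z, add3, scal3, dot3, E3; unfold c1, c2, c3; simpl; ring.
    + ck.
  - intros s t Hs.
    assert (E := profile_linear _ _ _ _ _ _ _ _ _ 1 a (revolution_profile_eqs c0 HEL)
                   ltac:(unfold a; field; exact H0) s ltac:(lra)).
    destruct (along_position s t) as (_ & _ & P3); [lra |].
    destruct (along_normal s t Hs) as (_ & _ & N3).
    assert (EH := mean_curvature_rotation s t Hs).
    transitivity ((along phi (mean_curvature X) s t + c0) * (along phi (comp3 X) s t + a)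
                  + along phi (comp3 (normal X)) s t).
    + unfold along, comp3, translate_z, add3, scal3, dot3, E3; unfold c1, c2, c3; simpl; ring.
    + rewrite EH, P3, N3; lra.
Qed.

End Revolution.

Theorem theorem4p1 :
  forall (c0 : R) (X : R -> R -> vec3),
    immersion_C4 X ->
    axially_symmetric X ->
    helfrich_critical c0 X ->
    (planar_disc X /\ - c0 = 0 /\
       (forall u v, closed_disc u v -> mean_curvature X u v = - c0))
    \/
    (spherical_cap X /\ - c0 <> 0 /\
       (forall u v, closed_disc u v -> mean_curvature X u v = - c0))
    \/
    (exists t : R, reduced_membrane c0 (translate_z t X)).
Proof.
  intros c0 X HX (phi & r & h & Hphi & _ & Hrot) HEL.
  destruct (Req_dec (along phi (mean_curvature X) 0 0 + c0) 0) as [H0 | H0].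
  - assert (HH := proj2 (cmc_disc X phi r h HX Hphi Hrot c0 HEL H0)).
    destruct (Req_dec c0 0) as [Hc | Hc]; [left | right; left].
    + split; [apply (planar_case X phi r h HX Hphi Hrot c0 HEL Hc H0) |].
      split; [lra | exact HH].
    + split; [apply (spherical_case X phi r h HX Hphi Hrot c0 HEL Hc H0) |].
      split; [lra | exact HH].
  - right; right; apply (reduced_membrane_case X phi r h HX Hphi Hrot c0 HEL H0).
Qed.
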